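(* Let $X,U$ be Hilbert spaces, let $A:D(A)\to X$ generate a $C_0$-semigroup $(S(t))_{t\ge 0}$ on $X$, and let $B\in L(U,X)$. Let $T>0$ and $\alpha>0$ be arbitrary. The following are equivalent: (i) The control system $\dot y(t)=Ay(t)+Bu(t)$ is $\alpha$-null controllable in time $T$. (ii) For every $y_0\in X$, $\mu_{y_0,\alpha}^T<+\infty$. (iii) For every $y_0\in X$, there exists $C>0$ such that $$\langle\psi,S(T)y_0\rangle_X\le C\,\Vert B^*S(T-\cdot)^*\psi\Vert_{L^2(0,T;U)}+\alpha\Vert y_0\Vert_X\Vert\psi\Vert_X\qquad\forall\psi\in X.$$ Moreover, when one of these items is satisfied, for every $y_0\in X$ the smallest constant $C\ge 0$ for which the inequality in (iii) holds for all $\psi\in X$ is $C=\mu_{y_0,\alpha}^T$.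
   Context: $X$ and $U$ are identified with their duals. In inequalities, $\langle\cdot,\cdot\rangle_X$ is the real scalar product (the real part of the inner product if $X$ is complex). For $y_0\in X$ and $u\in L^2(0,T;U)$, the solution of $\dot y=Ay+Bu$, $y(0)=y_0$, is the mild solution $y(T;y_0,u)=S(T)y_0+\int_0^TS(T-t)Bu(t)\,dt$. The system is $\alpha$-null controllable in time $T$ if for every $y_0\in X$ there exists $u\in L^2(0,T;U)$ such that $\Vert y(T;y_0,u)\Vert_X\le\alpha\Vert y_0\Vert_X$. Notation: $\Vert B^*S(T-\cdot)^*\psi\Vert_{L^2(0,T;U)}=\left(\int_0^T\Vert B^*S(T-t)^*\psi\Vert_U^2\,dt\right)^{1/2}$, and $$\mu_{y_0,\alpha}^T=\inf\left\{C\ge 0\ \mid\ \langle\psi,S(T)y_0\rangle_X-\alpha\Vert y_0\Vert_X\Vert\psi\Vert_X\le C\,\Vert B^*S(T-\cdot)^*\psi\Vert_{L^2(0,T;U)}\ \ \forall\psi\in X\right\}\in[0,+\infty],$$ with the convention $\inf\emptyset=+\infty$. *)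

(* Defs.v *)
From HB Require Import structures.
From mathcomp Require Import all_boot all_order all_algebra.
From mathcomp Require Import all_classical all_reals all_analysis.
From mathcomp Require Import complex.

Set Implicit Arguments.
Unset Strict Implicit.
Unset Printing Implicit Defensive.

Import Order.TTheory GRing.Theory Num.Theory.
Import numFieldNormedType.Exports.

Local Open Scope classical_set_scope.
Local Open Scope ring_scope.

(* Real and complex Hilbert spaces are treated at once: the scalar field is
   [scalar_field R k], that is R or R[i] according to [k]. *)
Inductive scalar_kind := RealScalars | ComplexScalars.

Definition scalar_field (R : realType) (k : scalar_kind) : numFieldType :=
  match k with
  | RealScalars => R
  | ComplexScalars => R[i]
  end.

Definition scalar_conj (R : realType) (k : scalar_kind) :
    scalar_field R k -> scalar_field R k :=
  match k with
  | RealScalars => fun x : R => x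
  | ComplexScalars => fun z : R[i] => conjc z
  end.

Definition scalar_Re (R : realType) (k : scalar_kind) : scalar_field R k -> R :=
  match k with
  | RealScalars => fun x : R => x
  | ComplexScalars => fun z : R[i] => complex.Re z
  end.

Definition scalar_of_real (R : realType) (k : scalar_kind) :
    R -> scalar_field R k :=
  match k with
  | RealScalars => fun x : R => x
  | ComplexScalars => fun x : R => Complex x 0
  end.

Lemma scalar_conj_is_zmod_morphism (R : realType) (k : scalar_kind) :
  zmod_morphism (@scalar_conj R k).
Proof. by case: k => // x y; exact: rmorphB. Qed.

Lemma scalar_conj_is_monoid_morphism (R : realType) (k : scalar_kind) :
  monoid_morphism (@scalar_conj R k).
Proof.
by case: k; split=> // [|x y]; [exact: rmorph1|exact: rmorphM].
Qed.

HB.instance Definition _ (R : realType) (k : scalar_kind) :=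
  GRing.isZmodMorphism.Build _ _ (@scalar_conj R k)
    (@scalar_conj_is_zmod_morphism R k).

HB.instance Definition _ (R : realType) (k : scalar_kind) :=
  GRing.isMonoidMorphism.Build _ _ (@scalar_conj R k)
    (@scalar_conj_is_monoid_morphism R k).

(* The inner product [hdot] is linear in its first argument. *)
HB.mixin Record CompleteNormedModule_isHilbert (R : realType) (k : scalar_kind)
    V of CompleteNormedModule (scalar_field R k) V := {
  hdot : {dot V for @scalar_conj R k} ;
  hdot_norm : forall x : V, hdot x x = `|x| ^+ 2
}.

#[short(type="hilbertType")]
HB.structure Definition Hilbert (R : realType) (k : scalar_kind) :=
  {V of CompleteNormedModule (scalar_field R k) V &
        CompleteNormedModule_isHilbert R k V}.

Section hilbert.
Variables (R : realType) (k : scalar_kind).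
Implicit Types X Y V : hilbertType R k.

Definition rdot X (x y : X) : R := scalar_Re (hdot x y).

(* The library norm [`|x|] has its values in [scalar_field R k]. *)
Definition rnorm X (x : X) : R := scalar_Re `|x|.

(* By the Riesz representation theorem the set below is a singleton when L is
   linear and continuous; elsewhere the value is irrelevant. *)
Definition adjoint X Y (L : X -> Y) (y : Y) : X :=
  xget 0 [set x' | forall x : X, hdot (L x) y = hdot x x'].

Definition simple_fun V (s : R -> V) : Prop :=
  finite_set (range s) /\
  forall v : V, measurable (s @^-1` [set v] : set (measurableTypeR R)).

(* For D of finite measure. *)
Definition simple_integral V (D : set R) (s : R -> V) : V :=
  \sum_(v \in range s)
    scalar_of_real k (fine (lebesgue_measure (D `&` s @^-1` [set v]))) *: v.

Definition strongly_measurable V (D : set R) (f : R -> V) : Prop :=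
  exists s : nat -> R -> V, (forall n, simple_fun (s n)) /\
    forall t, D t -> s n t @[n --> \oo] --> f t.

(* Elements of L^2(D; V) are given by their strongly measurable
   representatives; every almost-everywhere class contains one. *)
Definition L2_fun V (D : set R) (f : R -> V) : Prop :=
  strongly_measurable D f /\
  (\int[lebesgue_measure]_(t in D) (rnorm (f t) ^+ 2)%:E < +oo)%E.

Definition is_bochner_integral V (D : set R) (f : R -> V) (z : V) : Prop :=
  strongly_measurable D f /\
  exists s : nat -> R -> V, [/\ forall n, simple_fun (s n),
    (\int[lebesgue_measure]_(t in D) (rnorm (f t - s n t))%:E)%E
      @[n --> \oo] --> 0%E
    & simple_integral D (s n) @[n --> \oo] --> z].

Definition bochner_integral V (D : set R) (f : R -> V) : V :=
  xget 0 (is_bochner_integral D f).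

(* Only the values S t with 0 <= t matter. *)
Record C0_semigroup X (S : R -> X -> X) : Prop := {
  semigroup_linear : forall t, 0 <= t -> linear (S t) ;
  semigroup_bounded : forall t, 0 <= t -> continuous (S t) ;
  semigroup0 : forall x, S 0 x = x ;
  semigroupD : forall s t, 0 <= s -> 0 <= t ->
    forall x, S (s + t) x = S s (S t x) ;
  semigroup_strongly_continuous : forall x, S t x @[t --> 0^'+] --> x
}.

Definition difference_quotient X (S : R -> X -> X) (x : X) (h : R) : X :=
  scalar_of_real k h^-1 *: (S h x - x).

Definition is_generator X (S : R -> X -> X) (DA : set X) (A : DA -> X) : Prop :=
  DA = [set x | exists z : X,
         difference_quotient S x h @[h --> 0^'+] --> z] /\
  forall x : DA, difference_quotient S (set_val x) h @[h --> 0^'+] --> A x.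

Section control.
Variables (X U : hilbertType R k) (S : R -> X -> X) (B : U -> X) (T alpha : R).

(* Mild solution at time T of y' = A y + B u, y(0) = y0. *)
Definition mild_solution (y0 : X) (u : R -> U) : X :=
  S T y0 + bochner_integral `]0, T[ (fun t => S (T - t) (B (u t))).

Definition null_controllable : Prop :=
  forall y0 : X, exists2 u : R -> U, L2_fun `]0, T[ u &
    rnorm (mild_solution y0 u) <= alpha * rnorm y0.

Definition observation_norm (psi : X) : R :=
  Num.sqrt (\int[lebesgue_measure]_(t in `]0, T[)
    (rnorm (adjoint B (adjoint (S (T - t)) psi)) ^+ 2)).

Definition mu (y0 : X) : \bar R :=
  ereal_inf [set C%:E | C in [set C : R | 0 <= C /\ forall psi : X,
    rdot psi (S T y0) - alpha * rnorm y0 * rnorm psi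
      <= C * observation_norm psi]].

Definition observability_inequality (y0 : X) (C : R) : Prop :=
  forall psi : X,
    rdot psi (S T y0) <=
      C * observation_norm psi + alpha * rnorm y0 * rnorm psi.

End control.
End hilbert.

(* Main.v *)
Require Import Defs.
From HB Require Import structures.
From mathcomp Require Import all_boot all_order all_algebra.
From mathcomp Require Import all_classical all_reals all_analysis.
From mathcomp Require Import finmap measurable_realfun complex ring lra.

Set Implicit Arguments.
Unset Strict Implicit.
Unset Printing Implicit Defensive.

Import Order.TTheory GRing.Theory Num.Theory.
Import numFieldNormedType.Exports.

Local Open Scope classical_set_scope.
Local Open Scope ring_scope.

(** Write [f psi t = B^* S(T - t)^* psi] and [G u] for the integral of
    [S(T - t) B u(t)] over ]0, T[, so that [rdot (G u) psi] is the L^2 pairing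
    of [u] and [f psi]. Hence (i) implies (iii) by Cauchy-Schwarz. Conversely,
    let [z] be the element of minimal norm in the closure of
    [{S(T) y0 + G u : u simple, |u| <= C}]: testing its variational inequality
    with multiples of simple approximations of [- f z] gives
    [C |f z| <= <z, S(T) y0> - |z|^2], and (iii) at [psi = z] yields
    [|z| <= alpha |y0|]. Thus for every [n] some control of norm at most [C]
    steers [y0] into the ball of radius [alpha |y0| + 1 / (n + 1)]. Almost
    minimal such controls form, by the parallelogram identity, a Cauchy sequence
    in L^2, and its limit is the required control. *)

(** * Hilbert spaces as real inner product spaces *)

(** Two obstacles shape the proof. The first is the strong measurability of [f psi]: the adjoint
    semigroup is at the outset only weakly continuous in time. Strong right continuity at positive
    times can be extracted from this, and replacing [t] by simple functions of time that stay below
    [t] then gives simple, uniformly bounded approximations of [f psi]. The same time approximation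
    handles [S(T - t) B u(t)]. The second is that the projection onto a closure only yields controls
    that miss the target ball by an arbitrarily small amount, and the image of a ball of controls is
    not known to be closed. No weak compactness is invoked. The minimal energies over the decreasing
    sets of controls reaching the enlarged balls are nondecreasing and bounded by [C^2], so they
    converge, and convexity turns this into strong convergence of the controls themselves. Vector
    integrals are always handled by duality: they are paired with a vector, often the very one to be
    estimated, and become real integrals. *)

Section scalars.
Variables (R : realType) (k : scalar_kind).
Local Notation K := (scalar_field R k).
Local Notation "r %:K" := (scalar_of_real k r : K) (at level 2, format "r %:K").

Lemma scalar_of_realD (a b : R) : (a + b)%:K = a%:K + b%:K.
Proof. by case: k => //=; apply/eqP; rewrite eq_complex /= addr0 !eqxx. Qed.

Lemma scalar_of_realM (a b : R) : (a * b)%:K = a%:K * b%:K.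
Proof.
by case: k => //=; apply/eqP; rewrite eq_complex /= !mulr0 !mul0r subr0 addr0 !eqxx.
Qed.

Lemma scalar_of_real1 : 1%:K = 1.
Proof. by case: k. Qed.

Lemma scalar_of_real0 : 0%:K = 0.
Proof. by case: k. Qed.

Lemma scalar_of_realN (a : R) : (- a)%:K = - a%:K.
Proof. by case: k => //=; apply/eqP; rewrite eq_complex /= oppr0 !eqxx. Qed.

Lemma scalar_of_real_norm (a : R) : `|a%:K| = `|a|%:K.
Proof. by case: k => //=; rewrite normc_def /= expr0n addr0 sqrtr_sqr. Qed.

Lemma scalar_Re_is_zmod_morphism : zmod_morphism (@scalar_Re R k).
Proof. by case: k => // -[a b] [c d]. Qed.

HB.instance Definition _ := GRing.isZmodMorphism.Build K R (@scalar_Re R k)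
  scalar_Re_is_zmod_morphism.

Lemma scalar_ReM (a : R) (z : K) : scalar_Re (a%:K * z) = a * scalar_Re z.
Proof. by move: z; case: k => //= -[x y] /=; rewrite mul0r subr0. Qed.

Lemma scalar_Re_conj (z : K) : scalar_Re (scalar_conj z) = scalar_Re z.
Proof. by move: z; case: k => //= -[x y]. Qed.

Lemma scalar_Re_of_real (a : R) : scalar_Re a%:K = a.
Proof. by case: k. Qed.

Lemma ge0_scalar_ReK (z : K) : 0 <= z -> (scalar_Re z)%:K = z.
Proof. by move: z; case: k => //= -[x y]; rewrite lecE /= => /andP[/eqP->]. Qed.

Lemma le_scalar_of_real (a b : R) : (a%:K <= b%:K) = (a <= b).
Proof. by case: k => //=; rewrite lecE /= eqxx. Qed.

Lemma lt_scalar_of_real (a b : R) : (a%:K < b%:K) = (a < b).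
Proof. by case: k => //=; rewrite ltcE /= eqxx. Qed.

End scalars.

Section hilbert_geometry.
Variables (R : realType) (k : scalar_kind).
Implicit Types X Y : hilbertType R k.
Local Notation K := (scalar_field R k).

Definition rscale X (r : R) (x : X) : X := scalar_of_real k r *: x.

Lemma rscaleDr X r (x y : X) : rscale r (x + y) = rscale r x + rscale r y.
Proof. exact: scalerDr. Qed.

Lemma rscaleDl X r s (x : X) : rscale (r + s) x = rscale r x + rscale s x.
Proof. by rewrite /rscale scalar_of_realD scalerDl. Qed.

Lemma rscale1 X (x : X) : rscale 1 x = x.
Proof. by rewrite /rscale scalar_of_real1 scale1r. Qed.

Lemma rscale0 X (x : X) : rscale 0 x = 0.
Proof. by rewrite /rscale scalar_of_real0 scale0r. Qed.

Lemma rscaleN1 X (x : X) : rscale (-1) x = - x.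
Proof. by rewrite /rscale scalar_of_realN scalar_of_real1 scaleN1r. Qed.

Lemma hdotC X (x y : X) : hdot x y = scalar_conj (hdot y x).
Proof. by rewrite hermC expr0 mul1r. Qed.

Lemma rdotC X (x y : X) : rdot x y = rdot y x.
Proof. by rewrite /rdot hdotC scalar_Re_conj. Qed.

Lemma rdotDl X (x y z : X) : rdot (x + y) z = rdot x z + rdot y z.
Proof. by rewrite /rdot linearDl raddfD. Qed.

Lemma rdotZl X r (x z : X) : rdot (rscale r x) z = r * rdot x z.
Proof. by rewrite /rdot /rscale linearZl_LR scalar_ReM. Qed.

Lemma rdotNl X (x z : X) : rdot (- x) z = - rdot x z.
Proof. by rewrite -rscaleN1 rdotZl mulN1r. Qed.

Lemma rdotBl X (x y z : X) : rdot (x - y) z = rdot x z - rdot y z.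
Proof. by rewrite rdotDl rdotNl. Qed.

Lemma rdot0l X (z : X) : rdot 0 z = 0.
Proof. by rewrite -[0](rscale0 0) rdotZl mul0r. Qed.

Lemma rdotDr X (x y z : X) : rdot z (x + y) = rdot z x + rdot z y.
Proof. by rewrite !(rdotC z) rdotDl. Qed.

Lemma rdotZr X r (x z : X) : rdot z (rscale r x) = r * rdot z x.
Proof. by rewrite !(rdotC z) rdotZl. Qed.

Lemma rdotNr X (x z : X) : rdot z (- x) = - rdot z x.
Proof. by rewrite !(rdotC z) rdotNl. Qed.

Lemma rdotBr X (x y z : X) : rdot z (x - y) = rdot z x - rdot z y.
Proof. by rewrite rdotDr rdotNr. Qed.

Lemma normE X (x : X) : `|x| = scalar_of_real k (rnorm x).
Proof. by rewrite /rnorm ge0_scalar_ReK. Qed.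

Lemma rnorm_sqr X (x : X) : rnorm x ^+ 2 = rdot x x.
Proof.
by rewrite /rdot hdot_norm normE !expr2 -scalar_of_realM scalar_Re_of_real.
Qed.

Lemma rnorm_ge0 X (x : X) : 0 <= rnorm x.
Proof. by rewrite -(le_scalar_of_real k) scalar_of_real0 -normE. Qed.

Lemma rnorm0 X : rnorm (0 : X) = 0.
Proof. by rewrite /rnorm normr0 raddf0. Qed.

Lemma rnorm_eq0 X (x : X) : rnorm x = 0 -> x = 0.
Proof. by move=> x0; apply/normr0_eq0; rewrite normE x0 scalar_of_real0. Qed.

Lemma rnormZ X r (x : X) : rnorm (rscale r x) = `|r| * rnorm x.
Proof. by rewrite /rnorm normrZ scalar_of_real_norm scalar_ReM. Qed.

Lemma rnormN X (x : X) : rnorm (- x) = rnorm x.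
Proof. by rewrite /rnorm normrN. Qed.

Lemma rnormC X (x y : X) : rnorm (x - y) = rnorm (y - x).
Proof. by rewrite -rnormN opprB. Qed.

Lemma rnormD X (x y : X) : rnorm (x + y) <= rnorm x + rnorm y.
Proof.
by rewrite -(le_scalar_of_real k) scalar_of_realD -!normE ler_normD.
Qed.

Lemma rnormB X (x y : X) : rnorm (x - y) <= rnorm x + rnorm y.
Proof. by rewrite -(rnormN y) rnormD. Qed.

Lemma rnorm_triangle X (y x z : X) :
  rnorm (x - z) <= rnorm (x - y) + rnorm (y - z).
Proof. by rewrite -{1}(subrK y x) -addrA rnormD. Qed.

Lemma rnorm_dist X (x y : X) : `|rnorm x - rnorm y| <= rnorm (x - y).
Proof.
have h (u v : X) : rnorm u - rnorm v <= rnorm (u - v).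
  by rewrite lerBlDr -{1}(subrK v u) rnormD.
by rewrite ler_norml h andbT lerNl opprB rnormC h.
Qed.

Lemma rnormD_sqr X (x y : X) :
  rnorm (x + y) ^+ 2 = rnorm x ^+ 2 + 2 * rdot x y + rnorm y ^+ 2.
Proof.
by rewrite !rnorm_sqr rdotDl !rdotDr (rdotC y x); ring.
Qed.

Lemma rnormB_sqr X (x y : X) :
  rnorm (x - y) ^+ 2 = rnorm x ^+ 2 - 2 * rdot x y + rnorm y ^+ 2.
Proof. by rewrite rnormD_sqr rnormN rdotNr; ring. Qed.

Lemma rnormZ_sqr X r (x : X) : rnorm (rscale r x) ^+ 2 = r ^+ 2 * rnorm x ^+ 2.
Proof. by rewrite !rnorm_sqr rdotZl rdotZr mulrA expr2. Qed.

(** Expanding the square of the norm of [|v| u - |u| v] gives [2 |u| |v| (|u| |v| - <u, v>) >= 0];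
    the division by [|u| |v|] explains the two degenerate cases. *)
Lemma rdot_le X (x y : X) : `|rdot x y| <= rnorm x * rnorm y.
Proof.
have h (u v : X) : rdot u v <= rnorm u * rnorm v.
  have := sqr_ge0 (rnorm (rscale (rnorm v) u - rscale (rnorm u) v)).
  rewrite rnormB_sqr !rnormZ rdotZl rdotZr.
  rewrite !ger0_norm ?rnorm_ge0// => H.
  have [u0|u0] := eqVneq (rnorm u) 0.
    by rewrite u0 mul0r (rnorm_eq0 u0) rdot0l.
  have [v0|v0] := eqVneq (rnorm v) 0.
    by rewrite v0 mulr0 (rnorm_eq0 v0) rdotC rdot0l.
  have u1 : 0 < rnorm u by rewrite lt_def u0 rnorm_ge0.
  have v1 : 0 < rnorm v by rewrite lt_def v0 rnorm_ge0.
  rewrite -(ler_pM2l (mulr_gt0 u1 v1)); nra.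
by rewrite ler_norml h andbT lerNl -rdotNl (le_trans (h _ _))// rnormN.
Qed.

(** Positive elements of the scalar field are real even in the complex case, so its epsilons can be
    exchanged for epsilons in [R]. All later limit arguments rely on this translation. *)
Lemma cvg_rnormP (T : Type) (F : set_system T) {FF : Filter F} X (f : T -> X)
    (z : X) :
  f x @[x --> F] --> z <-> forall e : R, 0 < e ->
    \forall x \near F, rnorm (f x - z) < e.
Proof.
split.
  move=> /cvgrPdist_lt fz e e0.
  have e0' : 0 < scalar_of_real k e.
    by rewrite -(scalar_of_real0 R k) lt_scalar_of_real.
  apply: filterS (fz _ e0') => x.
  by rewrite normE lt_scalar_of_real rnormC.
move=> fz; apply/cvgrPdist_lt => e e0.
have e0' : 0 < scalar_Re e.
  by rewrite -(lt_scalar_of_real k) scalar_of_real0 ge0_scalar_ReK// ltW.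
apply: filterS (fz _ e0') => x.
by rewrite -[e in _ -> _ < e]ge0_scalar_ReK ?ltW// normE lt_scalar_of_real rnormC.
Qed.

Lemma rnorm_cvg (T : Type) (F : set_system T) {FF : Filter F} X (f : T -> X)
    (z : X) : f x @[x --> F] --> z -> rnorm (f x) @[x --> F] --> rnorm z.
Proof.
move=> /cvg_rnormP fz; apply/cvgrPdist_lt => e e0.
apply: filterS (fz _ e0) => x; apply: le_lt_trans.
by rewrite rnormC rnorm_dist.
Qed.

(** Polarization reduces the joint continuity of [rdot] to that of the norm. *)
Lemma rdot_cvg (T : Type) (F : set_system T) {FF : Filter F} X (f g : T -> X)
    (y z : X) : f x @[x --> F] --> y -> g x @[x --> F] --> z ->
  rdot (f x) (g x) @[x --> F] --> rdot y z.
Proof.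
have e1 (u v : X) : rdot u v = (rnorm (u + v) ^+ 2 - rnorm (u - v) ^+ 2) / 4.
  by rewrite rnormD_sqr rnormB_sqr; field.
move=> fy gz; rewrite e1; under eq_fun do rewrite e1.
apply: cvgMl; apply: cvgB; rewrite expr2; under eq_fun do rewrite expr2.
  by apply: cvgM; apply: rnorm_cvg; exact: cvgD.
by apply: cvgM; apply: rnorm_cvg; exact: cvgB.
Qed.

Lemma rscale_cvg (T : Type) (F : set_system T) {FF : Filter F} X (f : T -> X)
    (z : X) r : f x @[x --> F] --> z -> rscale r (f x) @[x --> F] --> rscale r z.
Proof. exact: cvgZr. Qed.

Lemma rnorm_complete X (x : nat -> X) :
  (forall e : R, 0 < e -> exists N, forall n m, (N <= n)%N -> (N <= m)%N ->
     rnorm (x n - x m) < e) -> cvgn x.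
Proof.
move=> xC; apply/cauchy_cvgP/cauchy_ballP => e e0; near_simpl.
have e0' : 0 < scalar_Re e.
  by rewrite -(lt_scalar_of_real k) scalar_of_real0 ge0_scalar_ReK// ltW.
have [N xN] := xC _ e0'.
exists ([set n | N <= n], [set n | N <= n])%N; first by split; exists N.
move=> [n m] [/= Nn Nm]; rewrite -ball_normE /ball_/=.
by rewrite -[e]ge0_scalar_ReK ?ltW// normE lt_scalar_of_real xN.
Qed.

(** Test with [z = x - y]. Real parts alone separate points, which reduces vector identities such as
    the adjoint semigroup law or the linearity of [reach] to scalar ones. *)
Lemma eq_rdot X (x y : X) : (forall z, rdot x z = rdot y z) -> x = y.
Proof.
move=> xy; apply/eqP; rewrite -subr_eq0; apply/eqP/rnorm_eq0/eqP.
by rewrite -sqrf_eq0 rnorm_sqr rdotBl xy subrr.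
Qed.

End hilbert_geometry.

(* The parallelogram identity makes almost-minimizers of a quadratic form over
   a decreasing sequence of convex sets a Cauchy sequence. *)
Lemma almost_minimizers_cauchy (R : realType) (E : Type) (F : nat -> set E)
    (q : E -> R) (d : E -> E -> R) (mid : E -> E -> E) (M : R) :
  (forall n m, (n <= m)%N -> F m `<=` F n) ->
  (forall n u v, F n u -> F n v -> F n (mid u v)) ->
  (forall u v, F 0%N u -> F 0%N v ->
    d u v = 2 * q u + 2 * q v - 4 * q (mid u v)) ->
  (forall u, 0 <= q u) ->
  (forall n, exists2 u, F n u & q u <= M) ->
  exists u : nat -> E, [/\ forall n, F n (u n),
    forall n w, F n w -> q (u n) <= q w + n.+1%:R^-1 &
    forall e, 0 < e -> exists N, forall n m, (N <= n)%N -> (N <= m)%N ->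
      d (u n) (u m) < e].
Proof.
move=> Fd Fmid dE q0 FM.
pose i n := inf (q @` F n).
have hi n : has_inf (q @` F n).
  have [u Fu _] := FM n; split; first by exists (q u); exists u.
  by exists 0 => _ [w _ <-].
have i_le n w : F n w -> i n <= q w.
  by move=> Fw; apply: ge_inf; [exact: (hi n).2|exists w].
have iM n : i n <= M.
  by have [u Fu] := FM n; apply: le_trans; exact: i_le.
have ind : nondecreasing_seq i.
  move=> n m nm; apply: lb_le_inf; first exact: (hi m).1.
  by move=> _ [w Fw <-]; apply: i_le; exact: Fd Fw.
have icvg : cvgn i.
  apply: nondecreasing_is_cvgn => //.
  by exists M => _ [n _ <-].
have iL n : i n <= limn i by exact: nondecreasing_cvgn_le.
have uex n : exists u, F n u /\ q u < i n + n.+1%:R^-1.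
  have n0 : 0 < n.+1%:R^-1 :> R by rewrite invr_gt0 ltr0n.
  have [_ [u Fu <-] qu] := inf_adherent n0 (hi n).
  by exists u.
pose u n := projT1 (cid (uex n)).
have uF n : F n (u n) := (projT2 (cid (uex n))).1.
have uq n : q (u n) < i n + n.+1%:R^-1 := (projT2 (cid (uex n))).2.
exists u; split => //.
  by move=> n w Fw; rewrite (le_trans (ltW (uq n)))// lerD2r i_le.
move=> e e0.
(* Let [L] be the limit of the infima. The values [q (u n)] and [q (u m)] stay below [L + e / 8],
   and the midpoint, which lies in [F (minn n m)], has value above [L - e / 8]. The identity for [d]
   then leaves less than [4 * (e / 8) + 4 * (e / 8) = e]. *)
have e8 : 0 < e / 8 by rewrite divr_gt0.
have [N1 _ N1P] : \forall n \near \oo, limn i - i n < e / 8.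
  move/cvgrPdist_lt : icvg => /(_ _ e8); apply: filterS => n.
  by apply: le_lt_trans; rewrite ler_norm.
have [N2 _ N2P] : \forall n \near \oo, n.+1%:R^-1 < e / 8.
  exact: near_infty_natSinv_lt (PosNum e8).
exists (maxn N1 N2) => n m; rewrite !geq_max => /andP[n1 n2] /andP[m1 m2].
have Fn : F (minn n m) (u n) by apply: Fd (uF n); exact: geq_minl.
have Fm : F (minn n m) (u m) by apply: Fd (uF m); exact: geq_minr.
have h1 := i_le _ _ (Fmid _ _ _ Fn Fm).
have h2 : limn i - i (minn n m) < e / 8 by apply: N1P; rewrite /= leq_min n1 m1.
have h3 : q (u n) < limn i + e / 8.
  by rewrite (lt_le_trans (uq n))// lerD// ltW//; exact: N2P.
have h4 : q (u m) < limn i + e / 8.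
  by rewrite (lt_le_trans (uq m))// lerD// ltW//; exact: N2P.
rewrite dE; [|exact: Fd (uF n)|exact: Fd (uF m)].
move: (limn i) h2 h3 h4 => li; lra.
Qed.

(** * Minimal-norm points of convex sets, Riesz representation and adjoints *)

Section hilbert_projection.
Variables (R : realType) (k : scalar_kind).
Implicit Types X Y : hilbertType R k.

Definition rconvex X (C : set X) := forall x y r, C x -> C y -> 0 <= r <= 1 ->
  C (rscale (1 - r) x + rscale r y).

Lemma min_norm X (C : set X) : C !=set0 -> rconvex C ->
  exists z, (exists2 x : nat -> X, forall n, C (x n) & x @ \oo --> z) /\
            forall w, C w -> rnorm z ^+ 2 <= rdot w z.
Proof.
move=> [w0 Cw0] Cconv.
have := @almost_minimizers_cauchy R X (fun=> C) (fun x => rnorm x ^+ 2)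
  (fun x y => rnorm (x - y) ^+ 2)
  (fun x y => rscale (1 - 2^-1) x + rscale 2^-1 y) (rnorm w0 ^+ 2).
case=> //.
- by move=> n m _ x.
- by move=> _ u v Cu Cv; apply: Cconv => //; apply/andP; split; lra.
- move=> u v _ _ /=; rewrite !rnormB_sqr rnormD_sqr !rnormZ_sqr rdotZl rdotZr.
  by field.
- by move=> u; rewrite sqr_ge0.
- by move=> _; exists w0.
move=> x [Cx xmin xC].
have /cvg_ex[z xz] : cvgn x.
  apply: rnorm_complete => e e0.
  have [N NP] := xC _ (exprn_gt0 2 e0); exists N => n m Nn Nm.
  by have := NP _ _ Nn Nm; rewrite ltr_pXn2r// nnegrE ?rnorm_ge0// ltW.
have zmin w : C w -> rnorm z ^+ 2 <= rnorm w ^+ 2.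
  move=> Cw; rewrite -[leRHS]addr0.
  apply: (@ler_cvg_to nat \oo _ R (fun n => rnorm (x n) ^+ 2)
    (fun n => rnorm w ^+ 2 + n.+1%:R^-1)).
  - rewrite expr2; under eq_fun do rewrite expr2.
    by apply: cvgM; exact: rnorm_cvg.
  - by apply: cvgD; [exact: cvg_cst|exact: cvg_harmonic].
  - by apply: nearW => n; exact: xmin.
exists z; split; first by exists x.
move=> w Cw; rewrite leNgt; apply/negP => wz.
have h l : 0 <= l <= 1 -> rnorm z ^+ 2 <= rnorm (rscale (1 - l) z + rscale l w) ^+ 2.
  move=> l01.
  have cv : rnorm (rscale (1 - l) (x n) + rscale l w) @[n --> \oo] -->
      rnorm (rscale (1 - l) z + rscale l w).
    by apply: rnorm_cvg; apply: cvgD; [exact: rscale_cvg|exact: cvg_cst].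
  apply: (@ler_cvg_to nat \oo _ R (fun=> rnorm z ^+ 2)
    (fun n => rnorm (rscale (1 - l) (x n) + rscale l w) ^+ 2)).
  - exact: cvg_cst.
  - by rewrite expr2; under eq_fun do rewrite expr2; exact: cvgM.
  by apply: nearW => n; apply: zmin; exact: Cconv.
pose N := rnorm z ^+ 2; pose D := rnorm (z - w) ^+ 2.
have D0 : 0 <= D by rewrite sqr_ge0.
have DE : D = N - 2 * rdot w z + rnorm w ^+ 2 by rewrite /D rnormB_sqr (rdotC z).
(* Minimality at the point [(1 - l) z + l w] gives [2 (N - <w, z>) <= l D]. Since [den] exceeds both
   [D] and [N - <w, z>], the choice of [l] ensures [l <= 1] and [l D < N - <w, z>], a
   contradiction. *)
pose den := D + (N - rdot w z) + 1.
have den0 : 0 < den by rewrite /den; move: wz; rewrite -/N; lra.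
pose l := (N - rdot w z) / den.
have lden : l * den = N - rdot w z by rewrite /l divfK// gt_eqF.
have l0 : 0 < l by rewrite divr_gt0// subr_gt0.
have l1 : l <= 1 by rewrite ler_pdivrMr// mul1r /den; lra.
have := h l; rewrite (ltW l0) l1 => /(_ isT).
rewrite rnormD_sqr !rnormZ_sqr rdotZl rdotZr (rdotC z) -/N => H.
have H2 : 2 * (N - rdot w z) <= l * D.
  rewrite -(ler_pM2l l0) DE; nra.
have : l * D < N - rdot w z.
  by rewrite -lden ltr_pM2l// /den; move: wz; rewrite -/N; lra.
move: wz; rewrite -/N; lra.
Qed.

(** The minimal-norm point [z] of the hyperplane [phi = 1] is orthogonal to the kernel of [phi]; the
    representing vector is [z] divided by [|z|^2]. *)
Lemma riesz X (phi : X -> R) (M : R) :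
  (forall x y, phi (x + y) = phi x + phi y) ->
  (forall r x, phi (rscale r x) = r * phi x) ->
  (forall x, `|phi x| <= M * rnorm x) ->
  exists z, forall x, phi x = rdot x z.
Proof.
move=> phiD phiZ phiM.
have phiN x : phi (- x) = - phi x by rewrite -rscaleN1 phiZ mulN1r.
have [phi0|] := pselect (forall x, phi x = 0).
  by exists 0 => x; rewrite phi0 rdotC rdot0l.
move=> /existsNP[x0 /eqP phix0].
pose C := [set x | phi x = 1].
have [||z [[x Cx xz] zC]] := @min_norm X C.
- by exists (rscale (phi x0)^-1 x0); rewrite /C /= phiZ mulVf.
- move=> u v r; rewrite /C /= => u1 v1 _; rewrite phiD !phiZ u1 v1; lra.
(* [min_norm] only places [z] in the closure of the hyperplane. The denominator [|M| + 1] is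
   positive whatever the sign of [M]. *)
have phiz : phi z = 1.
  have cv : phi (x n) @[n --> \oo] --> phi z.
    apply/cvgrPdist_lt => e e0.
    have M1 : 0 < `|M| + 1 by rewrite ltr_wpDl.
    have /cvg_rnormP/(_ (e / (`|M| + 1))) := xz.
    move=> /(_ (divr_gt0 e0 M1)); apply: filterS => n.
    rewrite ltr_pdivlMr// mulrC; apply: le_lt_trans.
    rewrite distrC -phiN -phiD (le_trans (phiM _))// ler_wpM2r ?rnorm_ge0//.
    by rewrite (le_trans (ler_norm _))// lerDl.
  have := cvg_lim (@Rhausdorff R) cv.
  have -> : (fun n => phi (x n)) = fun=> 1 by apply/funext => n; exact: Cx.
  by rewrite lim_cst// => <-.
have z0 : 0 < rnorm z ^+ 2.
  rewrite exprn_gt0// lt_def rnorm_ge0 andbT; apply/eqP => /rnorm_eq0 z0.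
  by move: phiz; rewrite z0 -(rscale0 0) phiZ mul0r => /eqP; rewrite eq_sym oner_eq0.
(* If [<h, z>] were nonzero, subtracting [h / <h, z>] from [z] would stay in the hyperplane and
   lower the product with [z] to [|z|^2 - 1], against the variational inequality. *)
have ker h : phi h = 0 -> rdot h z = 0.
  move=> h0; apply/eqP/negPn/negP => hz.
  have : C (z + rscale (- (rdot h z)^-1) h).
    by rewrite /C /= phiD phiZ h0 mulr0 addr0.
  move=> /zC; rewrite rdotDl rdotZl mulNr mulVf// -rnorm_sqr; lra.
exists (rscale (rnorm z ^+ 2)^-1 z) => y.
have : rdot (y - rscale (phi y) z) z = 0.
  by apply: ker; rewrite phiD phiN phiZ phiz mulr1 subrr.
rewrite rdotBl rdotZl -rnorm_sqr => /eqP; rewrite subr_eq0 => /eqP yz.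
by rewrite rdotZr yz mulrCA mulVf ?mulr1// gt_eqF.
Qed.

Section linear_maps.
Variables (X Y : hilbertType R k) (L : X -> Y) (linL : linear L).

Lemma linear_rscale r x : L (rscale r x) = rscale r (L x).
Proof.
have L0 : L 0 = 0.
  by have := linL (-1) 0 0; rewrite !scaleN1r oppr0 addr0 addNr.
by rewrite /rscale -[_ *: x]addr0 linL L0 addr0.
Qed.

Lemma linear_add x y : L (x + y) = L x + L y.
Proof. by have := linL 1 x y; rewrite !scale1r. Qed.

Lemma linear_sub x y : L (x - y) = L x - L y.
Proof. by rewrite -rscaleN1 linear_add linear_rscale rscaleN1. Qed.

Lemma linear_continuous_rbounded : continuous L ->
  exists2 M : R, 0 < M & forall x, rnorm (L x) <= M * rnorm x.
Proof.
move=> cL.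
have L0 : L 0 = 0 by rewrite -(rscale0 0) linear_rscale rscale0.
have /cvg_rnormP/(_ 1 ltr01) := cL 0.
rewrite L0 => /nbhs_ballP[e /= e0 eL].
have e0' : 0 < scalar_Re e.
  by rewrite -(lt_scalar_of_real k) scalar_of_real0 ge0_scalar_ReK// ltW.
exists (2 / scalar_Re e) => [|x]; first by rewrite divr_gt0.
have [x0|x0] := eqVneq (rnorm x) 0.
  by rewrite (rnorm_eq0 x0) L0 !rnorm0 mulr0.
have x1 : 0 < rnorm x by rewrite lt_def x0 rnorm_ge0.
pose r := scalar_Re e / 2 / rnorm x.
have r0 : 0 < r by rewrite !divr_gt0.
have := eL (rscale r x).
rewrite -ball_normE /ball_ /= sub0r normrN normE.
rewrite -{1}(ge0_scalar_ReK (ltW e0)) lt_scalar_of_real rnormZ.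
rewrite (ger0_norm (ltW r0)) divfK//.
have re2 : scalar_Re e / 2 < scalar_Re e by lra.
move=> /(_ re2).
rewrite subr0 linear_rscale rnormZ (ger0_norm (ltW r0)) => H.
rewrite -(ler_pM2l r0); apply: (le_trans (ltW H)).
rewrite /r le_eqVlt; apply/orP; left; apply/eqP; field.
by rewrite x0 gt_eqF.
Qed.

(** Riesz gives a vector that represents the real part only, whereas [adjoint] is specified by the
    full inner product. Applying the real identity to [c *: u] with [c = 1] and [c = i] recovers
    both parts. *)
Lemma rdot_adjoint (M : R) : (forall x, rnorm (L x) <= M * rnorm x) ->
  forall x y, rdot (L x) y = rdot x (adjoint L y).
Proof.
move=> LM x y.
suff H : exists x', forall x, hdot (L x) y = hdot x x'.
  by rewrite /rdot /adjoint; congr scalar_Re; have /= -> := xgetPex 0 H.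
have [||x0|z zP] := @riesz X (fun x => rdot (L x) y) (M * rnorm y).
- by move=> u v; rewrite linear_add rdotDl.
- by move=> r u; rewrite linear_rscale rdotZl.
- rewrite (le_trans (rdot_le _ _))// mulrAC ler_wpM2r ?rnorm_ge0//.
exists z => u.
have {}zP c : scalar_Re (c * hdot (L u) y) = scalar_Re (c * hdot u z).
  have := zP (c *: u); rewrite /rdot linearZl_LR => <-.
  rewrite -linearZl_LR; congr (scalar_Re (hdot _ _)).
  have L0 : L 0 = 0 by rewrite -(rscale0 0) linear_rscale rscale0.
  by rewrite -[c *: u]addr0 linL L0 addr0.
move: (hdot (L u) y) (hdot u z) zP; case: k => /= [a b /(_ 1)|[a b] [c d] H].
  by rewrite !mul1r.
have /= := H 1; rewrite !mul1r !mul0r !subr0 => ->.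
by have /= := H (Complex 0 1); rewrite !mul0r !mul1r !sub0r => /oppr_inj ->.
Qed.

Lemma rnorm_adjoint (M : R) : 0 <= M -> (forall x, rnorm (L x) <= M * rnorm x) ->
  forall y, rnorm (adjoint L y) <= M * rnorm y.
Proof.
move=> M0 LM y.
have := rdot_adjoint LM (adjoint L y) y; rewrite -rnorm_sqr => H.
have [a0|a0] := eqVneq (rnorm (adjoint L y)) 0.
  by rewrite a0 mulr_ge0// rnorm_ge0.
have a1 : 0 < rnorm (adjoint L y) by rewrite lt_def a0 rnorm_ge0.
rewrite -(ler_pM2l a1) -expr2 -H (le_trans (ler_norm _))//.
by rewrite (le_trans (rdot_le _ _))// mulrA ler_wpM2r ?rnorm_ge0// mulrC.
Qed.

Lemma rdot_adjoint_sub (M : R) : (forall x, rnorm (L x) <= M * rnorm x) ->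
  forall y z, adjoint L (y - z) = adjoint L y - adjoint L z.
Proof.
move=> LM y z; apply: eq_rdot => w.
rewrite rdotC -(rdot_adjoint LM) rdotBr !(rdot_adjoint LM) -rdotBr.
exact: rdotC.
Qed.

End linear_maps.
End hilbert_projection.

(** * Bochner integral *)

Section simple_maps.
Variable R : realType.
Local Notation mR := (measurableTypeR R).

(* [simple_fun] for an arbitrary codomain. *)
Definition msimple (T : Type) (s : R -> T) : Prop :=
  finite_set (range s) /\ forall A : set T, measurable (s @^-1` A : set mR).

Lemma msimple_fibers (T : Type) (s : R -> T) : finite_set (range s) ->
  (forall v, measurable (s @^-1` [set v] : set mR)) -> msimple s.
Proof.
move=> sfin sm; split=> // A.
have -> : s @^-1` A = \bigcup_(v in range s `&` A) (s @^-1` [set v]).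
  apply/seteqP; split => [t At|t [v [_ Av] /= ->//]].
  by exists (s t) => //; split => //; exists t.
by apply: fin_bigcup_measurable => //; exact: finite_setIl.
Qed.

(** Used for maps that are far from continuous, such as [S (T - a) b] as a function of [a] and [b],
    or a cut-off by a boolean: only finitely many pairs of values occur, on measurable sets. *)
Lemma msimple_comp2 (T1 T2 T3 : Type) (F : T1 -> T2 -> T3) (s1 : R -> T1)
    (s2 : R -> T2) : msimple s1 -> msimple s2 -> msimple (fun t => F (s1 t) (s2 t)).
Proof.
move=> [f1 m1] [f2 m2]; apply: msimple_fibers; first exact: finite_image11.
move=> v.
have -> : (fun t => F (s1 t) (s2 t)) @^-1` [set v] =
    \bigcup_(a in range s1) (s1 @^-1` [set a] `&` s2 @^-1` [set b | F a b = v]).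
  apply/seteqP; split => [t /= tv|t [a _ [/= -> //]]].
  by exists (s1 t).
by apply: fin_bigcup_measurable => // a _; exact: measurableI.
Qed.

Lemma msimple_comp (T1 T2 : Type) (F : T1 -> T2) (s : R -> T1) :
  msimple s -> msimple (fun t => F (s t)).
Proof.
by move=> s1; exact: (msimple_comp2 (fun a _ => F a) s1 s1).
Qed.

Lemma msimple_cst (T : Type) (v : T) : msimple (fun _ : R => v).
Proof.
split; first exact: finite_image_cst.
by move=> A; rewrite preimage_cst; case: ifP.
Qed.

Lemma msimple_mem (E : set R) : measurable (E : set mR) ->
  msimple (fun t => t \in E).
Proof.
move=> mE; apply: msimple_fibers.
  by apply: (sub_finite_set (@subsetT _ _)); exact: finite_finset.
case.
- rewrite (_ : _ @^-1` _ = E)//.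
  by apply/seteqP; split => t /= => [/set_mem|/mem_set].
- rewrite (_ : _ @^-1` _ = ~` (E : set mR)); first exact: measurableC.
  apply/seteqP; split => t /=; first by move=> /negbT; rewrite notin_setE.
  by move=> tE; apply/negbTE; rewrite notin_setE.
Qed.

Lemma msimple_measurable (D : set R) (g : R -> R) : measurable (D : set mR) ->
  msimple g -> measurable_fun (D : set mR) g.
Proof. by move=> mD [_ mg] _ A mA; exact: measurableI. Qed.

Import HBNNSimple.

Lemma msimple_nnsfun (g : {nnsfun mR >-> R}) : msimple (g : R -> R).
Proof.
by apply: msimple_fibers => [|v]; [exact: (fimfunP g)|exact: (measurable_funPTI g)].
Qed.

Lemma msimple_bounded (T : Type) (s : R -> T) (N : T -> R) : msimple s ->
  exists2 M : R, 0 <= M & forall t, N (s t) <= M.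
Proof.
move=> [sfin _].
have [r rP] : exists r : seq R, [set` r] = N @` range s.
  have /finite_seqP[r rE] : finite_set (N @` range s) by exact: finite_image.
  by exists r.
exists (\sum_(x <- r) `|x|) => [|t]; first exact: sumr_ge0.
have tr : N (s t) \in r.
  have : (N @` range s) (N (s t)) by exists (s t) => //; exists t.
  by rewrite -rP.
by rewrite (big_rem _ tr)/= ler_wpDr ?sumr_ge0 ?ler_norm.
Qed.

End simple_maps.

Section bochner.
Variables (R : realType) (k : scalar_kind).
Implicit Types V W Z : hilbertType R k.
Local Notation mR := (measurableTypeR R).
Local Notation mu := (@lebesgue_measure R).
Variables (D : set R) (mD : measurable (D : set mR)) (finD : (mu D < +oo)%E).

Lemma simple_funP V (s : R -> V) : simple_fun s <-> msimple s.
Proof.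
split=> [[sfin sm]|[sfin sm]]; first exact: msimple_fibers.
by split.
Qed.

Definition rintegrable (f : R -> R) : Prop := mu.-integrable D (EFin \o f).

Lemma rintegrableD f g : rintegrable f -> rintegrable g ->
  rintegrable (fun t => f t + g t).
Proof. by move=> hf hg; exact: (integrableD mD hf hg). Qed.

Lemma rintegrableZ a f : rintegrable f -> rintegrable (fun t => a * f t).
Proof. by move=> hf; exact: (integrableZl mD a hf). Qed.

Lemma le_rintegrable (f g : R -> R) : measurable_fun (D : set mR) f ->
  (forall t, D t -> `|f t| <= g t) -> rintegrable g -> rintegrable f.
Proof.
move=> mf fg; apply: le_integrable => //; first exact/measurable_EFinP.
by move=> t Dt /=; rewrite lee_fin (le_trans (fg t Dt))// ler_norm.
Qed.

Lemma rintegrable_bounded (f : R -> R) M : measurable_fun (D : set mR) f ->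
  (forall t, D t -> `|f t| <= M) -> rintegrable f.
Proof.
move=> mf fM; apply: measurable_bounded_integrable => //.
by exists M; split => [|x Mx t Dt /=]; rewrite ?num_real// (le_trans (fM _ Dt))// ltW.
Qed.

Lemma rintegrable_simple (g : R -> R) : msimple g -> rintegrable g.
Proof.
move=> sg; have [M _ gM] := msimple_bounded (fun x : R => `|x|) sg.
by apply: (@rintegrable_bounded _ M) => //; exact: msimple_measurable.
Qed.

Lemma Rintegral_sum (I : Type) (r : seq I) (f : I -> R -> R) :
  (forall i, rintegrable (f i)) ->
  \int[mu]_(t in D) (\sum_(i <- r) f i t) =
  \sum_(i <- r) \int[mu]_(t in D) f i t.
Proof.
move=> hf; elim: r => [|i r IH].
  under eq_Rintegral do rewrite big_nil.
  by rewrite big_nil /Rintegral integral0.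
have hr : rintegrable (fun t => \sum_(i <- r) f i t).
  elim: {IH} r => [|j r IHr].
    rewrite (_ : (fun t => _) = fun=> 0).
      by apply: rintegrable_simple; exact: msimple_cst.
    by apply/funext => t; rewrite big_nil.
  rewrite (_ : (fun t => _) = fun t => f j t + \sum_(i <- r) f i t).
    exact: rintegrableD.
  by apply/funext => t; rewrite big_cons.
under eq_Rintegral do rewrite big_cons.
by rewrite big_cons (RintegralD mD (hf i) hr) IH.
Qed.

Lemma rdot_simple_integral V (s : R -> V) (w : V) : simple_fun s ->
  rdot (simple_integral D s) w = \int[mu]_(t in D) rdot (s t) w.
Proof.
move=> /simple_funP[sfin sm].
rewrite /simple_integral fsbig_finite//=.
set r := enum_fset (fset_set (range s)).
have -> : rdot (\sum_(v <- r) scalar_of_real k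
    (fine (mu (D `&` s @^-1` [set v]))) *: v) w =
    \sum_(v <- r) fine (mu (D `&` s @^-1` [set v])) * rdot v w.
  elim: r => [|v l IH]; first by rewrite !big_nil rdot0l.
  by rewrite !big_cons rdotDl IH -/(rscale _ _) rdotZl.
have hind v : rintegrable (\1_(s @^-1` [set v]) : R -> R).
  rewrite (_ : \1__ = fun t => (t \in s @^-1` [set v])%:R).
    apply: rintegrable_simple.
    exact: (msimple_comp (fun b : bool => b%:R) (msimple_mem (sm [set v]))).
  by apply/funext => t; rewrite indicE.
transitivity (\sum_(v <- r) \int[mu]_(t in D) (rdot v w * \1_(s @^-1` [set v]) t)).
  apply: eq_bigr => v _; rewrite (RintegralZl _ mD (hind v)).
  by rewrite mulrC /Rintegral integral_indic// setIC.
rewrite -Rintegral_sum; last by move=> v; exact: rintegrableZ.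
apply: eq_Rintegral => t _.
have tr : s t \in r.
  have : s t \in fset_set (range s) by rewrite in_fset_set// mem_set//; exists t.
  by [].
rewrite (big_rem _ tr) /= indicE mem_set// mulr1 big1_seq ?addr0//.
move=> v /andP[_]; rewrite mem_rem_uniq ?fset_uniq// inE => /andP[vs _].
rewrite indicE memNset ?mulr0//= => tv.
by move: vs; rewrite tv eqxx.
Qed.

Lemma strongly_measurable_comp V (f : R -> V) (phi : V -> R) :
  strongly_measurable D f ->
  (forall (x : nat -> V) z, x @ \oo --> z -> phi (x n) @[n --> \oo] --> phi z) ->
  measurable_fun (D : set mR) (fun t => phi (f t)).
Proof.
move=> [s [ss sf]] cphi.
apply: (@measurable_fun_cvg _ _ _ _ (fun n t => phi (s n t))).
  move=> n; apply: msimple_measurable => //.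
  by apply: msimple_comp; apply/simple_funP.
by move=> t Dt; apply: cphi; exact: sf.
Qed.

Lemma measurable_rdot V (f : R -> V) w : strongly_measurable D f ->
  measurable_fun (D : set mR) (fun t => rdot (f t) w).
Proof.
move=> mf; apply: (strongly_measurable_comp (phi := fun v => rdot v w)) => //.
by move=> x z xz; apply: rdot_cvg => //; exact: cvg_cst.
Qed.

Lemma measurable_rnorm V (f : R -> V) : strongly_measurable D f ->
  measurable_fun (D : set mR) (fun t => rnorm (f t)).
Proof.
move=> mf; apply: (strongly_measurable_comp (phi := @rnorm R k V)) => //.
by move=> x z xz; exact: rnorm_cvg.
Qed.

Lemma simple_strongly_measurable V (s : R -> V) : simple_fun s ->
  strongly_measurable D s.
Proof. by move=> ss; exists (fun=> s); split => // t _; exact: cvg_cst. Qed.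

Lemma strongly_measurable_sub V (f g : R -> V) : strongly_measurable D f ->
  strongly_measurable D g -> strongly_measurable D (fun t => f t - g t).
Proof.
move=> [s [ss sf]] [s' [ss' sg]]; exists (fun n t => s n t - s' n t); split.
  move=> n; apply/simple_funP; apply: (msimple_comp2 (fun a b => a - b)).
    exact/simple_funP.
  exact/simple_funP.
by move=> t Dt; apply: cvgB; [exact: sf|exact: sg].
Qed.

Definition L1_fun V (f : R -> V) : Prop :=
  strongly_measurable D f /\ rintegrable (fun t => rnorm (f t)).

Lemma L1_sub V (f g : R -> V) : L1_fun f -> L1_fun g ->
  L1_fun (fun t => f t - g t).
Proof.
move=> [mf hf] [mg hg].
have mfg := strongly_measurable_sub mf mg; split => //.
apply: le_rintegrable (rintegrableD hf hg); first exact: measurable_rnorm.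
by move=> t _; rewrite ger0_norm ?rnorm_ge0// rnormB.
Qed.

Lemma simple_L1 V (s : R -> V) : simple_fun s -> L1_fun s.
Proof.
move=> ss; split; first exact: simple_strongly_measurable.
by apply: rintegrable_simple; apply: msimple_comp; exact/simple_funP.
Qed.

Lemma L1_rdot V (f : R -> V) w : L1_fun f -> rintegrable (fun t => rdot (f t) w).
Proof.
move=> [mf hf]; apply: le_rintegrable (rintegrableZ (rnorm w) hf).
  exact: measurable_rdot.
by move=> t _; rewrite mulrC rdot_le.
Qed.

(** The factor [rnorm w] is what yields norm estimates by duality: [L1_bochner_ex] and [reach_dist]
    take for [w] the difference to be bounded and cancel one power of its norm. *)
Lemma Rintegral_rdot_dist V (f g : R -> V) w : L1_fun f -> L1_fun g ->
  `|\int[mu]_(t in D) rdot (f t) w - \int[mu]_(t in D) rdot (g t) w| <=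
  rnorm w * \int[mu]_(t in D) rnorm (f t - g t).
Proof.
move=> hf hg.
rewrite -RintegralB//; [|exact: L1_rdot|exact: L1_rdot].
under eq_Rintegral do rewrite -rdotBl.
have hfg := L1_sub hf hg.
rewrite (le_trans (le_normr_Rintegral _ (L1_rdot w hfg)))//.
rewrite -RintegralZl//; last exact: hfg.2.
apply: le_Rintegral => //.
- by have := L1_rdot w hfg; rewrite /rintegrable => /integrable_norm.
- exact: (rintegrableZ _ hfg.2).
- by move=> t _; rewrite mulrC rdot_le.
Qed.

Lemma Rintegral_cvg0 (f : nat -> R -> R) :
  (\int[mu]_(t in D) (f n t)%:E)%E @[n --> \oo] --> 0%E ->
  \int[mu]_(t in D) f n t @[n --> \oo] --> 0.
Proof. exact: fine_cvg. Qed.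

(** Since this holds for every admissible [z], the integral is unique and the choice hidden in
    [bochner_integral] is harmless. *)
Lemma rdot_is_bochner_integral V (f : R -> V) z w : L1_fun f ->
  is_bochner_integral D f z -> rdot z w = \int[mu]_(t in D) rdot (f t) w.
Proof.
move=> hf [_ [s [ss s0 sz]]].
have c1 : rdot (simple_integral D (s n)) w @[n --> \oo] --> rdot z w.
  by apply: rdot_cvg => //; exact: cvg_cst.
suff c2 : rdot (simple_integral D (s n)) w @[n --> \oo] -->
    \int[mu]_(t in D) rdot (f t) w.
  exact: (cvg_unique _ c1 c2).
apply/cvgrPdist_le => e e0.
have w1 : 0 < rnorm w + 1 by rewrite ltr_wpDl ?rnorm_ge0.
have /Rintegral_cvg0/cvgrPdist_lt/(_ (e / (rnorm w + 1)) (divr_gt0 e0 w1)) := s0.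
apply: filterS => n; rewrite sub0r normrN => H.
rewrite rdot_simple_integral//.
apply: (le_trans (Rintegral_rdot_dist w hf (simple_L1 (ss n)))).
have I0 : 0 <= \int[mu]_(t in D) rnorm (f t - s n t).
  by apply: Rintegral_ge0 => t _; exact: rnorm_ge0.
rewrite ger0_norm// in H.
have -> : e = (rnorm w + 1) * (e / (rnorm w + 1)).
  by rewrite mulrC divfK// gt_eqF.
by apply: ler_pM => //; [exact: rnorm_ge0|rewrite lerDl|exact: ltW].
Qed.

(* Cutting the simple approximations off where they exceed [2 |f|] makes
   dominated convergence applicable. *)
Lemma L1_bochner_ex V (f : R -> V) : L1_fun f ->
  exists z, is_bochner_integral D f z.
Proof.
move=> hf; have [s [ss sf]] := hf.1.
have mf := measurable_rnorm hf.1.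
pose E n := D `&` [set t | rnorm (s n t) <= 2 * rnorm (f t)].
have mE n : measurable (E n : set mR).
  rewrite /E.
  have := @measurable_fun_ler _ _ _ D (fun t => rnorm (s n t))
    (fun t => 2 * rnorm (f t)).
  have m1 : measurable_fun (D : set mR) (fun t => rnorm (s n t)).
    by apply: measurable_rnorm; exact: simple_strongly_measurable.
  have m2 : measurable_fun (D : set mR) (fun t => 2 * rnorm (f t)).
    by apply: measurable_funM => //; exact: measurable_cst.
  by move=> /(_ m1 m2 mD [set true]) /(_ _); exact.
pose s' n t : V := if t \in E n then s n t else 0.
have ss' n : simple_fun (s' n).
  apply/simple_funP; apply: (msimple_comp2 (fun (b : bool) v => if b then v else 0)).
    exact: msimple_mem.
  exact/simple_funP.
have s'f t : D t -> s' n t @[n --> \oo] --> f t.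
  move=> Dt; apply/cvg_rnormP => e e0.
  have /cvg_rnormP sft := sf _ Dt.
  (* Where [f t = 0], the truncated sequence is identically zero. Elsewhere the truncation is
     inactive as soon as [s n t] is within [rnorm (f t)] of [f t]. *)
  have [ft0|ft0] := eqVneq (rnorm (f t)) 0.
    apply: filterS (sft _ e0) => n _; rewrite /s'; case: ifPn => [/set_mem[_ /=]|_].
      rewrite ft0 mulr0 => sn.
      have -> : s n t = 0.
        by apply: rnorm_eq0; apply/eqP; rewrite eq_le sn rnorm_ge0.
      by rewrite sub0r rnormN ft0.
    by rewrite sub0r rnormN ft0.
  have ft1 : 0 < rnorm (f t) by rewrite lt_def ft0 rnorm_ge0.
  apply: filterS2 (sft _ e0) (sft _ ft1) => n h1 h2.
  rewrite /s' mem_set//; split => //=.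
  have := rnormD (s n t - f t) (f t); rewrite subrK; lra.
have s'le n t : D t -> rnorm (f t - s' n t) <= 3 * rnorm (f t).
  move=> Dt; have f0 := rnorm_ge0 (f t).
  apply: le_trans (rnormB _ _) _; rewrite /s'; case: ifPn.
    by move=> /set_mem[_ /=]; lra.
  move=> _.
  by rewrite rnorm0; lra.
have I0 : (\int[mu]_(t in D) (rnorm (f t - s' n t))%:E)%E @[n --> \oo] --> 0%E.
  have <- : (\int[mu]_(t in D) (cst 0%E t) = 0)%E by exact: integral0.
  apply: (@dominated_cvg _ _ _ mu D mD _ _ (fun t => (3 * rnorm (f t))%:E)).
  - move=> n; apply/measurable_EFinP; apply: measurable_rnorm.
    by apply: strongly_measurable_sub hf.1 _; exact: simple_strongly_measurable.
  - move=> t Dt; apply/fine_cvgP; split; first exact: nearW.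
    have := s'f _ Dt => /cvg_rnormP H.
    apply/cvgrPdist_lt => e e0; apply: filterS (H _ e0) => n /=.
    by rewrite sub0r normrN ger0_norm ?rnorm_ge0// rnormC.
  - by [].
  - exact: rintegrableZ hf.2.
  - by move=> n t Dt; rewrite /= ger0_norm ?rnorm_ge0// lee_fin s'le.
have /cvg_ex[z zP] : cvgn (fun n => simple_integral D (s' n)).
  apply: rnorm_complete => e e0.
  have e2 : 0 < e / 2 by rewrite divr_gt0.
  have /Rintegral_cvg0/cvgrPdist_lt/(_ _ e2)[N _ NP] := I0.
  exists N => n m Nn Nm.
  set w := simple_integral D (s' n) - simple_integral D (s' m).
  have [w0|w0] := eqVneq (rnorm w) 0; first by rewrite w0.
  have w1 : 0 < rnorm w by rewrite lt_def w0 rnorm_ge0.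
  rewrite -(ltr_pM2l w1) -expr2 rnorm_sqr {1}/w rdotBl !rdot_simple_integral//.
  have h p : (N <= p)%N -> `|\int[mu]_(t in D) rdot (f t) w -
      \int[mu]_(t in D) rdot (s' p t) w| < rnorm w * (e / 2).
    move=> Np; apply: (le_lt_trans (Rintegral_rdot_dist w hf (simple_L1 (ss' p)))).
    rewrite ltr_pM2l//; have := NP p Np; rewrite /= sub0r normrN.
    by apply: le_lt_trans; exact: ler_norm.
  have := h n Nn; have := h m Nm; rewrite !ltr_norml => /andP[a1 a2] /andP[b1 b2].
  lra.
by exists z; split; [exact: hf.1|exists s'].
Qed.

Lemma rdot_bochner_integral V (f : R -> V) w : L1_fun f ->
  rdot (bochner_integral D f) w = \int[mu]_(t in D) rdot (f t) w.
Proof.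
move=> hf; apply: rdot_is_bochner_integral => //.
exact: (xgetPex _ (L1_bochner_ex hf)).
Qed.

End bochner.

(** * Semigroups and their adjoints *)

Section nested_balls.
Variables (R : realType) (k : scalar_kind) (X : hilbertType R k).

(** Baire's argument: choose closed balls one inside the other with radii at least halved. Their
    centers form a Cauchy sequence whose limit belongs to every ball, hence satisfies every
    [P n]. *)
Lemma nested_balls (P : nat -> X -> Prop) :
  (forall n c r, 0 < r -> exists c' r', [/\ 0 < r', r' <= r / 2 &
     forall z, rnorm (z - c') <= r' -> rnorm (z - c) <= r /\ P n z]) ->
  exists x, forall n, P n x.
Proof.
move=> step.
have /choice[g gP] (q : nat * (X * R)) : exists p : X * R, 0 < q.2.2 ->
    [/\ 0 < p.2, p.2 <= q.2.2 / 2 & forall z, rnorm (z - p.1) <= p.2 ->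
      rnorm (z - q.2.1) <= q.2.2 /\ P q.1 z].
  case: q => n [c r] /=; have [r0|r0] := ltP 0 r.
    by have [c' [r' H]] := step n c r r0; exists (c', r').
  by exists (c, r); rewrite ltNge r0.
pose b := fix b n := if n is m.+1 then g (m, b m) else (0, 1).
have b0 n : 0 < (b n).2.
  by elim: n => [|n IH] //=; have [] := gP (n, b n) IH.
have bS n := gP (n, b n) (b0 n).
have bnest n m z : (n <= m)%N -> rnorm (z - (b m).1) <= (b m).2 ->
    rnorm (z - (b n).1) <= (b n).2.
  elim: m => [|m IH]; first by rewrite leqn0 => /eqP->.
  rewrite leq_eqVlt => /orP[/eqP->//|nm] zm; apply: IH => //.
  by have [_ _ /(_ _ zm)[]] := bS m.
have bdist n m : (n <= m)%N -> rnorm ((b m).1 - (b n).1) <= (b n).2.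
  by move=> nm; apply: bnest nm _; rewrite subrr rnorm0 ltW.
have bsmall n : (b n).2 <= 2^-1 ^+ n.
  elim: n => [|n IH] //=; have [_ h _] := bS n; apply: (le_trans h).
  by rewrite exprSr ler_wpM2r.
have /cvg_ex[x bx] : cvgn (fun n => (b n).1).
  apply: rnorm_complete => e e0.
  have e2 : 0 < e / 2 by rewrite divr_gt0.
  have /cvgrPdist_lt/(_ _ e2)[N _ NP] : (2^-1 : R) ^+ n @[n --> \oo] --> 0.
    by apply: cvg_expr; rewrite ger0_norm ?invf_lt1 ?ltr1n.
  have bN : (b N).2 < e / 2.
    apply: le_lt_trans (bsmall N) _; have := NP N (leqnn N).
    by rewrite sub0r normrN; apply: le_lt_trans; exact: ler_norm.
  exists N => n m Nn Nm.
  apply: le_lt_trans (rnorm_triangle (b N).1 _ _) _.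
  rewrite (rnormC (b N).1) [e]splitr ltrD//.
    exact: le_lt_trans (bdist _ _ Nn) bN.
  exact: le_lt_trans (bdist _ _ Nm) bN.
exists x => n; have [_ _ /(_ x)[]//] := bS n.
(* The limit stays in the closed ball of index [n.+1]: pass to the limit in the triangle inequality
   through the later centers. *)
apply: (@ler_cvg_to nat \oo _ R (fun m => rnorm (x - (b n.+1).1)
  - rnorm (x - (b m).1)) (fun=> (b n.+1).2)).
- rewrite -[X in _ --> X]subr0; apply: cvgB; first exact: cvg_cst.
  rewrite -[X in _ --> X](rnorm0 X) -(subrr x); apply: rnorm_cvg.
  by apply: cvgB => //; exact: cvg_cst.
- exact: cvg_cst.
- near=> m; have nm : (n.+1 <= m)%N by near: m; exists n.+1.
  have := rnorm_triangle (b m).1 x (b n.+1).1; have := bdist _ _ nm.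
  move: (rnorm _) (rnorm _) (rnorm _) => *; lra.
Unshelve. all: by end_near. Qed.

End nested_balls.

Section semigroups.
Variables (R : realType) (k : scalar_kind) (X : hilbertType R k).
Variables (S : R -> X -> X) (hS : C0_semigroup S).

Lemma semigroup_rbounded t : 0 <= t ->
  exists2 M : R, 0 < M & forall x, rnorm (S t x) <= M * rnorm x.
Proof.
move=> t0; apply: linear_continuous_rbounded; first exact: (semigroup_linear hS).
exact: (semigroup_bounded hS).
Qed.

Lemma semigroup_right_cvg x (e : R) : 0 < e ->
  exists2 d : R, 0 < d & forall h, 0 <= h < d -> rnorm (S h x - x) < e.
Proof.
move=> e0.
have /cvg_rnormP/(_ e e0) := semigroup_strongly_continuous hS (x := x).
move=> /nbhs_ballP[d /= d0 dP]; exists d => // h /andP[h0 hd].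
move: h0; rewrite le_eqVlt => /predU1P[<-|h0].
  by rewrite (semigroup0 hS) subrr rnorm0.
by apply: dP => //; rewrite /ball /= sub0r normrN gtr0_norm.
Qed.

(* Principle of uniform boundedness: otherwise a vector with unbounded orbit
   near 0 would exist. *)
Lemma semigroup_bounded_near0 : exists d M : R, [/\ 0 < d, 1 <= M &
  forall t x, 0 <= t <= d -> rnorm (S t x) <= M * rnorm x].
Proof.
apply: contrapT => H.
have [|x xP] := @nested_balls R k X
    (fun n x => exists2 t, 0 <= t <= n.+1%:R^-1 & n%:R < rnorm (S t x)).
  move=> n c r r0.
  have [t [y [t0 yr ny]]] : exists t y, [/\ 0 <= t <= n.+1%:R^-1,
      rnorm (y - c) < r & n%:R < rnorm (S t y)].
    apply: contrapT => H1; apply: H.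
    have {}H1 t y : 0 <= t <= n.+1%:R^-1 -> rnorm (y - c) < r ->
        rnorm (S t y) <= n%:R.
      by move=> t0 yr; rewrite leNgt; apply/negP => ny; apply: H1; exists t, y.
    (* A bound [n] on the ball of radius [r] around [c] gives the bound [2 n] on differences
       [S t (c + a x) - S t c]; with [a x] of norm [r / 2] this is the operator bound [4 n / r]. *)
    exists n.+1%:R^-1, (Num.max 1 (4 * n%:R / r)); split.
    - by rewrite invr_gt0 ltr0n.
    - by rewrite le_max lexx.
    move=> t x t0.
    have linS : linear (S t).
      by apply: (semigroup_linear hS); case/andP: t0.
    have [x0|x0] := eqVneq (rnorm x) 0.
      rewrite x0 mulr0 (rnorm_eq0 x0) -(rscale0 0) (linear_rscale linS).
      by rewrite rscale0 rnorm0.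
    have x1 : 0 < rnorm x by rewrite lt_def x0 rnorm_ge0.
    pose a := r / 2 / rnorm x.
    have a0 : 0 < a by rewrite !divr_gt0.
    have ax : rnorm (rscale a x) < r.
      by rewrite rnormZ (ger0_norm (ltW a0)) divfK//; lra.
    have h1 : rnorm (S t (c + rscale a x)) <= n%:R.
      by apply: H1 => //; rewrite [c + _]addrC addrK.
    have h2 : rnorm (S t c) <= n%:R by apply: H1 => //; rewrite subrr rnorm0.
    have h3 : a * rnorm (S t x) <= 2 * n%:R.
      have -> : a * rnorm (S t x) = rnorm (S t (c + rscale a x) - S t c).
        rewrite -(linear_sub linS) [c + _]addrC addrK (linear_rscale linS).
        by rewrite rnormZ (ger0_norm (ltW a0)).
      by apply: le_trans (rnormB _ _) _; lra.
    apply: (@le_trans _ _ (4 * n%:R / r * rnorm x)).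
      rewrite -(ler_pM2l a0); apply: (le_trans h3).
      rewrite le_eqVlt; apply/orP; left; apply/eqP; rewrite /a; field.
      by rewrite x0 gt_eqF.
    by rewrite ler_wpM2r ?rnorm_ge0// le_max lexx orbT.
  have [t1 _] := andP t0.
  have [K K0 KP] := semigroup_rbounded t1.
  (* The three terms provide the halving of the radius, the inclusion in the old ball, and the
     persistence of [n < rnorm (S t z)] on the new one, as [S t] varies by at most half of the
     excess there. *)
  pose r1 := Num.min (r / 2) (Num.min (r - rnorm (y - c))
    ((rnorm (S t y) - n%:R) / (2 * K))).
  have r1_gt0 : 0 < r1.
    by rewrite !lt_min divr_gt0//= subr_gt0 yr/= divr_gt0 ?subr_gt0// mulr_gt0.
  have [r1a r1b r1c] : [/\ r1 <= r / 2, r1 <= r - rnorm (y - c) &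
      r1 <= (rnorm (S t y) - n%:R) / (2 * K)].
    by rewrite /r1 !ge_min !lexx !orbT.
  exists y, r1; split => // z zy; split.
    by apply: le_trans (rnorm_triangle y _ _) _; lra.
  exists t => //.
  have linS : linear (S t) by exact: (semigroup_linear hS).
  have := KP (y - z); rewrite (linear_sub linS) (rnormC y) => h1.
  have h2 : rnorm (S t y) <= rnorm (S t y - S t z) + rnorm (S t z).
    by rewrite -{1}(subrK (S t z) (S t y)) rnormD.
  have h3 : K * rnorm (z - y) <= (rnorm (S t y) - n%:R) / 2.
    apply: (@le_trans _ _ (K * ((rnorm (S t y) - n%:R) / (2 * K)))).
      by rewrite ler_wpM2l ?(ltW K0)// (le_trans zy).
    by rewrite le_eqVlt; apply/orP; left; apply/eqP; field; rewrite gt_eqF.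
  by move: h1 h2 h3 ny; lra.
have [d d0 dP] := semigroup_right_cvg x ltr01.
have [N _ NP] : \forall n \near \oo, n.+1%:R^-1 < d.
  exact: near_infty_natSinv_lt (PosNum d0).
(* This [n] is so large that [n.+1%:R^-1 < d], where orbits of [x] are bounded by [rnorm x + 1], and
   also that [rnorm x + 1 < n]. *)
pose n := maxn N (Num.truncn (rnorm x + 1)).+1.
have nx : rnorm x + 1 < n%:R.
  apply: lt_le_trans (truncnS_gt _) _.
  by rewrite ler_nat leq_maxr.
have nd : n.+1%:R^-1 < d by apply: NP; rewrite /= leq_maxl.
have [t /andP[t0 tn] nS] := xP n.
have : rnorm (S t x - x) < 1 by apply: dP; rewrite t0 (le_lt_trans tn).
have := rnormD (S t x - x) x; rewrite subrK; lra.
Qed.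

Lemma semigroup_bounded_on (T : R) : exists2 M : R, 1 <= M &
  forall t x, 0 <= t <= T -> rnorm (S t x) <= M * rnorm x.
Proof.
have [d [M [d0 M1 MP]]] := semigroup_bounded_near0.
have H n t x : 0 <= t <= n%:R * d -> rnorm (S t x) <= M ^+ n * rnorm x.
  elim: n t x => [|n IH] t x /andP[t0 tn].
    have -> : t = 0 by apply/eqP; rewrite eq_le t0 andbT -(mul0r d).
    by rewrite (semigroup0 hS) expr0 mul1r.
  have [td|td] := leP t d.
    apply: (le_trans (MP _ _ _)); first by rewrite t0.
    rewrite ler_wpM2r ?rnorm_ge0// exprS ler_peMr ?exprn_ege1//.
    exact: le_trans M1.
  have td0 : 0 <= t - d by rewrite subr_ge0 ltW.
  rewrite -(subrK d t) addrC (semigroupD hS)//; last exact: ltW.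
  apply: (le_trans (MP _ _ _)); first by rewrite (ltW d0) lexx.
  rewrite exprS -mulrA ler_wpM2l//; first exact: le_trans M1.
  apply: IH; rewrite td0 lerBlDr.
  by move: tn; rewrite -natr1 mulrDl mul1r.
pose n := (Num.truncn (T / d)).+1.
exists (M ^+ n); first exact: exprn_ege1.
move=> t x /andP[t0 tT]; apply: H; rewrite t0 (le_trans tT)//.
by rewrite -ler_pdivrMr// ltW// truncnS_gt.
Qed.

(** Adjoints reverse the order of composition, and commutativity of the addition of times restores
    it. *)
Lemma adjoint_semigroupD s t psi : 0 <= s -> 0 <= t ->
  adjoint (S (s + t)) psi = adjoint (S s) (adjoint (S t) psi).
Proof.
move=> s0 t0; apply: eq_rdot => x; rewrite !(rdotC _ x).
have [Ms _ MsP] := semigroup_rbounded s0.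
have [Mt _ MtP] := semigroup_rbounded t0.
have st0 : 0 <= s + t by rewrite addr_ge0.
have [Mst _ MstP] := semigroup_rbounded st0.
rewrite -(rdot_adjoint (semigroup_linear hS st0) MstP).
rewrite -(rdot_adjoint (semigroup_linear hS s0) MsP).
rewrite -(rdot_adjoint (semigroup_linear hS t0) MtP).
by rewrite addrC (semigroupD hS).
Qed.

(* Weak continuity of the adjoint semigroup becomes strong continuity near a
   point [t0] where [|S(t0)^* psi|] almost reaches its supremum over [[0, b[];
   this is then propagated to the right of [t0] by the semigroup law. *)
Lemma adjoint_semigroup_right_continuous (T b e : R) (psi : X) :
  0 < b -> b <= T -> 0 < e ->
  exists2 d : R, 0 < d & forall t h, b <= t -> 0 <= h < d -> t <= T ->
    rnorm (adjoint (S (t + h)) psi - adjoint (S t) psi) <= e.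
Proof.
move=> b0 bT e0.
have [M M1 MP] := semigroup_bounded_on T.
have M0 : 0 < M by exact: lt_le_trans M1.
pose Sa t := adjoint (S t) psi.
have SaM t phi : 0 <= t <= T -> rnorm (adjoint (S t) phi) <= M * rnorm phi.
  move=> /[dup] tT /andP[t0 _].
  apply: (rnorm_adjoint (semigroup_linear hS t0) (ltW M0)) => x.
  exact: MP.
pose G := [set rnorm (Sa t) ^+ 2 | t in [set t : R | 0 <= t < b]].
have Gsup : has_sup G.
  split; first by exists (rnorm (Sa 0) ^+ 2); exists 0 => //=; rewrite lexx.
  exists ((M * rnorm psi) ^+ 2) => _ [t /= /andP[t0 tb] <-].
  rewrite lerXn2r ?nnegrE ?rnorm_ge0 ?mulr_ge0 ?rnorm_ge0 ?(ltW M0)//.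
  by apply: SaM; rewrite t0 (le_trans (ltW tb)).
(* In the expansion of [|Sa (t0 + h) - w|^2], one [eps] comes from the near-maximality of [t0] and
   two from the doubled cross term. Dividing [e] by [M] pays for the later application of
   [adjoint (S (t - t0))]. *)
pose eps := (e / M) ^+ 2 / 3.
have eps0 : 0 < eps by rewrite divr_gt0// exprn_gt0// divr_gt0.
have [_ [t0 /= /andP[t00 t0b] <-] Gt0] := sup_adherent eps0 Gsup.
pose w := Sa t0.
have w1 : 0 < rnorm w + 1 by rewrite ltr_wpDl ?rnorm_ge0.
have [d1 d10 d1P] := semigroup_right_cvg w (divr_gt0 eps0 w1).
(* The bound [b - t0] keeps [t0 + h] in [[0, b[], where the supremum applies. The resulting [d] does
   not depend on [t]. *)
exists (Num.min d1 (b - t0)); first by rewrite lt_min d10 subr_gt0.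
move=> t h bt /andP[h0]; rewrite lt_min => /andP[hd1 hb] tT.
have near_w : rnorm (Sa (t0 + h) - w) ^+ 2 <= (e / M) ^+ 2.
  have -> : (e / M) ^+ 2 = 3 * eps by rewrite /eps; field; rewrite gt_eqF.
  have hG : rnorm (Sa (t0 + h)) ^+ 2 <= sup G.
    apply: sup_upper_bound => //; exists (t0 + h) => //=.
    by rewrite addr_ge0//=; move: hb; lra.
  (* Moving the adjoints across turns the cross term into [<S h w, w>], so only the strong
     continuity of [S] itself at [w] is needed. *)
  have dw : rdot (Sa (t0 + h)) w = rnorm w ^+ 2 + rdot (S h w - w) w.
    have th0 : 0 <= t0 + h by rewrite addr_ge0.
    have [Mt _ MtP] := semigroup_rbounded th0.
    have [Mt0 _ Mt0P] := semigroup_rbounded t00.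
    rewrite rdotC -(rdot_adjoint (semigroup_linear hS th0) MtP).
    rewrite (semigroupD hS)// (rdot_adjoint (semigroup_linear hS t00) Mt0P).
    by rewrite rdotBl rnorm_sqr addrC subrK.
  have sm : `|rdot (S h w - w) w| <= eps.
    apply: (le_trans (rdot_le _ _)).
    have hw : rnorm (S h w - w) < eps / (rnorm w + 1).
      by apply: d1P; rewrite h0.
    have -> : eps = eps / (rnorm w + 1) * (rnorm w + 1).
      by rewrite divfK// gt_eqF.
    by apply: ler_pM; rewrite ?rnorm_ge0 ?(ltW hw)// lerDl.
  have := ler_norm (- rdot (S h w - w) w); rewrite normrN => sm'.
  rewrite rnormB_sqr dw; move: Gt0; rewrite -/w; lra.
have near_w' : rnorm (Sa (t0 + h) - w) <= e / M.
  by rewrite -(@ler_pXn2r _ 2)// ?nnegrE ?rnorm_ge0// ltW// divr_gt0.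
have tt0 : 0 <= t - t0 by move: bt t0b; lra.
have -> : t + h = t - t0 + (t0 + h) by ring.
have -> : adjoint (S t) psi = adjoint (S (t - t0)) w.
  by rewrite -adjoint_semigroupD// subrK.
rewrite (adjoint_semigroupD _ tt0 (addr_ge0 t00 h0)).
have [Mt _ MtP] := semigroup_rbounded tt0.
rewrite -(rdot_adjoint_sub (semigroup_linear hS tt0) MtP).
apply: (le_trans (SaM _ _ _)); first by rewrite tt0/=; move: tT t00; lra.
by rewrite -ler_pdivlMl// mulrC.
Qed.

End semigroups.

(** * The control operator *)

Section approximation.
Variables (R : realType) (T : R).
Local Notation mR := (measurableTypeR R).
Local Notation mu := (@lebesgue_measure R).
Local Notation D := (`]0, T[%classic : set R).

Lemma measurable_horizon : measurable (D : set mR).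
Proof. exact: measurable_itv. Qed.

Lemma finite_horizon : (mu D < +oo)%E.
Proof. by rewrite lebesgue_measure_itv /=; case: ifP => // _; rewrite ltry. Qed.

Local Notation mD := measurable_horizon.

Import HBNNSimple.

(* Approximating [t] from below makes [T - tau n t] tend to [T - t] from the
   right, where the semigroup law gives continuity. *)
Lemma time_approx : exists tau : nat -> R -> R, (forall n, msimple (tau n)) /\
  forall t, D t -> (forall n, 0 <= tau n t <= t) /\ tau n t @[n --> \oo] --> t.
Proof.
have mid : measurable_fun (D : set mR) (fun t : mR => t%:E).
  exact/measurable_EFinP.
have pos (t : mR) : D t -> (0 <= t%:E)%E.
  by rewrite /= in_itv/= lee_fin => /andP[/ltW].
exists (fun n => nnsfun_approx mD mid n : R -> R); split.
  by move=> n; exact: msimple_nnsfun.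
move=> t Dt; split.
  move=> n; apply/andP; split; first exact: fun_ge0.
  by rewrite -lee_fin nnsfun_approxE le_approx.
exact: (fine_cvg (cvg_nnsfun_approx mD mid pos Dt)).
Qed.

Lemma Rintegral_bounded_cvg (g : nat -> R -> R) (h : R -> R) (M : R) :
  (forall n, measurable_fun (D : set mR) (g n)) ->
  (forall n t, D t -> `|g n t| <= M) ->
  (forall t, D t -> g n t @[n --> \oo] --> h t) ->
  \int[mu]_(t in D) g n t @[n --> \oo] --> \int[mu]_(t in D) h t.
Proof.
move=> mg gM gh.
have mh : measurable_fun (D : set mR) h.
  exact (@measurable_fun_cvg _ mR R D g h mg gh).
have hM t : D t -> `|h t| <= M.
  move=> Dt; apply: (@ler_cvg_to nat \oo _ R (fun n => `|g n t|) (fun=> M)).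
  - by apply: cvg_norm; exact: gh.
  - exact: cvg_cst.
  - by apply: nearW => n; exact: gM.
apply: fine_cvg; rewrite fineK; last first.
  have ih := rintegrable_bounded mD finite_horizon mh hM.
  exact: (integrable_fin_num mD ih).
apply: (@dominated_cvg _ _ _ mu D mD _ _ (fun=> M%:E)).
- by move=> n; exact/measurable_EFinP.
- move=> t Dt; apply/fine_cvgP; split; first exact: nearW.
  exact: gh.
- by [].
- exact: (rintegrable_simple mD finite_horizon (msimple_cst R M)).
- by move=> n t Dt /=; rewrite lee_fin; exact: gM.
Qed.

End approximation.

(** The choice [s = sqrt b], [t = sqrt a] is optimal. It degenerates when [a] or [b] vanishes, and
    then a large value of the matching parameter contradicts [0 < c]. *)
Lemma quadratic_cauchy_schwarz (R : realType) (a b c : R) : 0 <= a -> 0 <= b ->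
  (forall s t, 0 <= s -> 0 <= t -> 2 * (s * t) * c <= s ^+ 2 * a + t ^+ 2 * b) ->
  c <= Num.sqrt a * Num.sqrt b.
Proof.
move=> a0 b0 H; rewrite leNgt; apply/negP => cab.
have c0 : 0 < c by apply: le_lt_trans cab; rewrite mulr_ge0 ?sqrtr_ge0.
have small d : 0 <= d -> exists2 s : R, 0 <= s & d < 2 * s * c.
  move=> d0; exists ((d + 1) / (2 * c)).
    by rewrite divr_ge0 ?mulr_ge0 ?(ltW c0)// addr_ge0.
  have -> : 2 * ((d + 1) / (2 * c)) * c = d + 1 by field; rewrite gt_eqF.
  by rewrite ltrDl.
have [a1|a1] := eqVneq a 0.
  have [s s0 sb] := small b b0.
  by have := H s 1 s0 ler01; rewrite a1; lra.
have [b1|b1] := eqVneq b 0.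
  have [s s0 sb] := small a a0.
  by have := H 1 s ler01 s0; rewrite b1; lra.
have sa : 0 < Num.sqrt a by rewrite sqrtr_gt0 lt_def a1.
have sb : 0 < Num.sqrt b by rewrite sqrtr_gt0 lt_def b1.
have := H _ _ (ltW sb) (ltW sa); rewrite !sqr_sqrtr// => H1.
have ab : a * b = (Num.sqrt b * Num.sqrt a) ^+ 2 by rewrite exprMn !sqr_sqrtr// mulrC.
have : (Num.sqrt b * Num.sqrt a) * c <= (Num.sqrt b * Num.sqrt a) ^+ 2.
  by rewrite -ab; move: H1; rewrite [b * a]mulrC; lra.
by rewrite expr2 ler_pM2l ?mulr_gt0// mulrC leNgt cab.
Qed.

Section control_operator.
Variables (R : realType) (k : scalar_kind) (X U : hilbertType R k).
Variables (S : R -> X -> X) (hS : C0_semigroup S) (B : {linear U -> X}).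
Variables (T M KB : R).
Hypothesis M1 : 1 <= M.
Hypothesis MP : forall t x, 0 <= t <= T -> rnorm (S t x) <= M * rnorm x.
Hypothesis KB0 : 0 < KB.
Hypothesis KBP : forall u, rnorm (B u) <= KB * rnorm u.
Local Notation mR := (measurableTypeR R).
Local Notation mu := (@lebesgue_measure R).
Local Notation D := (`]0, T[%classic : set R).
Local Notation mD := (measurable_horizon T).
Local Notation finD := (finite_horizon T).

Let M0 : 0 < M. Proof. exact: lt_le_trans M1. Qed.

Let linB : linear B. Proof. exact: linearP. Qed.

Let horizonP t : D t -> 0 < t < T.
Proof. by rewrite /= in_itv. Qed.

(** Factor [S (T - tau n t)] as [S (T - t)] after [S (t - tau n t)]: the outer operator is bounded
    by [M], and the inner one tends strongly to the identity. *)
Lemma strongly_measurable_semigroup (x : R -> X) : strongly_measurable D x ->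
  strongly_measurable D (fun t => S (T - t) (x t)).
Proof.
move=> [s [ss sx]]; have [tau [tau_s tauP]] := time_approx T.
exists (fun n t => S (T - tau n t) (s n t)); split.
  move=> n; apply/simple_funP; apply: (msimple_comp2 (fun a b => S (T - a) b)) => //.
  exact/simple_funP.
move=> t Dt; have [tau_le tau_cvg] := tauP t Dt.
have /andP[t0 tT] := horizonP Dt.
apply/cvg_rnormP => e e0.
(* The total error is at most [M (M e1 + e2)], with both terms equal to [e / 2]. *)
pose e1 := e / (2 * M ^+ 2).
have e10 : 0 < e1 by rewrite divr_gt0// mulr_gt0// exprn_gt0.
pose e2 := e / (2 * M).
have e20 : 0 < e2 by rewrite divr_gt0// mulr_gt0.
have [d d0 dP] := semigroup_right_cvg hS (x t) e20.
have /cvg_rnormP/(_ e1 e10) H1 := sx t Dt.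
have /cvgrPdist_lt/(_ d d0) H2 := tau_cvg.
apply: filterS2 H1 H2 => n h1 h2.
have /andP[tau0 taut] := tau_le n.
have dt0 : 0 <= t - tau n t by rewrite subr_ge0.
rewrite ger0_norm// in h2.
have Tt0 : 0 <= T - t by rewrite subr_ge0 ltW.
have -> : T - tau n t = T - t + (t - tau n t) by ring.
rewrite (semigroupD hS)// -(linear_sub (semigroup_linear hS Tt0)).
apply: (le_lt_trans (MP _ _)); first by lra.
have h3 : rnorm (S (t - tau n t) (x t) - x t) < e2 by apply: dP; rewrite dt0.
have h4 : rnorm (S (t - tau n t) (s n t) - S (t - tau n t) (x t)) < e / (2 * M).
  rewrite -(linear_sub (semigroup_linear hS dt0)).
  apply: (le_lt_trans (MP _ _)); first by lra.
  rewrite -ltr_pdivlMl//; apply: (lt_le_trans h1).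
  rewrite le_eqVlt; apply/orP; left; apply/eqP; rewrite /e1; field.
  by rewrite gt_eqF.
have -> : e = M * (e / (2 * M) + e2) by rewrite /e2; field; rewrite gt_eqF.
rewrite ltr_pM2l//.
apply: (le_lt_trans (rnorm_triangle (S (t - tau n t) (x t)) _ _)).
by rewrite ltrD.
Qed.

Lemma strongly_measurable_bounded_linear (u : R -> U) : strongly_measurable D u ->
  strongly_measurable D (fun t => B (u t)).
Proof.
move=> [s [ss su]]; exists (fun n t => B (s n t)); split.
  by move=> n; apply/simple_funP; apply: msimple_comp; exact/simple_funP.
move=> t Dt; apply/cvg_rnormP => e e0.
have /cvg_rnormP/(_ _ (divr_gt0 e0 KB0)) := su t Dt; apply: filterS => n H.
rewrite -(linear_sub linB); apply: (le_lt_trans (KBP _)).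
by rewrite mulrC -ltr_pdivlMr.
Qed.

Definition observation (psi : X) (t : R) : U :=
  adjoint B (adjoint (S (T - t)) psi).

Lemma rdot_observation (u : U) psi t : D t ->
  rdot (S (T - t) (B u)) psi = rdot u (observation psi t).
Proof.
move=> /horizonP/andP[t0 tT].
have Tt : 0 <= T - t <= T by lra.
have [Tt0 _] := andP Tt.
rewrite (rdot_adjoint (semigroup_linear hS Tt0) (fun x => MP x Tt)).
by rewrite (rdot_adjoint linB KBP).
Qed.

Lemma rnorm_observation psi t : 0 <= t <= T ->
  rnorm (adjoint B (adjoint (S t) psi)) <= KB * (M * rnorm psi).
Proof.
move=> tT; have [t0 _] := andP tT.
apply: (le_trans (rnorm_adjoint linB (ltW KB0) KBP _)).
rewrite ler_pM2l//.
exact: (rnorm_adjoint (semigroup_linear hS t0) (ltW M0) (fun x => MP x tT)).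
Qed.

(** Right continuity of the adjoint semigroup is applied with lower time bound [T - t], positive on
    the open horizon. The uniform bound serves dominated convergence in [observation_dual_bound]. *)
Lemma observation_approx psi : exists v : nat -> R -> U,
  [/\ forall n, simple_fun (v n),
      forall n t, D t -> rnorm (v n t) <= KB * (M * rnorm psi) &
      forall t, D t -> v n t @[n --> \oo] --> observation psi t].
Proof.
have [tau [tau_s tauP]] := time_approx T.
exists (fun n t => adjoint B (adjoint (S (T - tau n t)) psi)); split.
- move=> n; apply/simple_funP.
  exact: (msimple_comp (fun a => adjoint B (adjoint (S (T - a)) psi))).
- move=> n t Dt; have [/(_ n)/andP[h1 h2] _] := tauP t Dt.
  by have /andP[t0 tT] := horizonP Dt; apply: rnorm_observation; lra.
move=> t Dt; have [tau_le tau_cvg] := tauP t Dt.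
have /andP[t0 tT] := horizonP Dt.
apply/cvg_rnormP => e e0.
have e1 : 0 < e / (2 * KB) by rewrite divr_gt0// mulr_gt0.
have Tt : 0 < T - t by rewrite subr_gt0.
have TtT : T - t <= T by lra.
have [d d0 dP] := adjoint_semigroup_right_continuous hS psi Tt TtT e1.
have /cvgrPdist_lt/(_ d d0) := tau_cvg.
apply: filterS => n h2; have /andP[tau0 taut] := tau_le n.
have dt0 : 0 <= t - tau n t by rewrite subr_ge0.
rewrite ger0_norm// in h2.
have := dP (T - t) (t - tau n t) (lexx _).
rewrite dt0 h2 => /(_ isT TtT) h.
have -> : T - tau n t = T - t + (t - tau n t) by ring.
rewrite /observation -(rdot_adjoint_sub linB KBP).
apply: (le_lt_trans (rnorm_adjoint linB (ltW KB0) KBP _)).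
apply: (@le_lt_trans _ _ (KB * (e / (2 * KB)))); first by rewrite ler_pM2l.
have -> : KB * (e / (2 * KB)) = e / 2 by field; rewrite gt_eqF.
lra.
Qed.

Lemma strongly_measurable_observation psi :
  strongly_measurable D (observation psi).
Proof. by have [v [sv _ vf]] := observation_approx psi; exists v. Qed.

Definition energy (u : R -> U) : R := \int[mu]_(t in D) rnorm (u t) ^+ 2.

Definition square_integrable (u : R -> U) : Prop :=
  rintegrable D (fun t => rnorm (u t) ^+ 2).

Lemma energy_ge0 u : 0 <= energy u.
Proof. by apply: Rintegral_ge0 => t _; exact: sqr_ge0. Qed.

Lemma measurable_rnorm_sqr (u : R -> U) : strongly_measurable D u ->
  measurable_fun (D : set mR) (fun t => rnorm (u t) ^+ 2).
Proof. by move=> mu_; apply: measurable_funX; exact: (measurable_rnorm mD mu_). Qed.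

Lemma L2_funP (u : R -> U) :
  L2_fun D u <-> strongly_measurable D u /\ square_integrable u.
Proof.
split=> -[mu_ u2]; split => //.
  apply/integrableP; split; first by apply/measurable_EFinP; exact: measurable_rnorm_sqr.
  by under eq_integral do rewrite /= ger0_norm ?sqr_ge0//.
by have /integrable_lty := u2; apply.
Qed.

Lemma square_integrable_observation psi : square_integrable (observation psi).
Proof.
apply: (rintegrable_bounded mD finD (M := (KB * (M * rnorm psi)) ^+ 2)).
  by apply: measurable_rnorm_sqr; exact: strongly_measurable_observation.
move=> t Dt; have /andP[t0 tT] := horizonP Dt.
rewrite ger0_norm ?sqr_ge0// lerXn2r ?nnegrE ?rnorm_ge0//.
  by rewrite !mulr_ge0 ?rnorm_ge0 ?(ltW KB0) ?(ltW M0).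
by apply: rnorm_observation; lra.
Qed.

(** On a finite horizon, [|u| <= 1 + |u|^2] suffices. *)
Lemma L2_L1 (u : R -> U) : L2_fun D u -> L1_fun D u.
Proof.
move=> /L2_funP[mu_ u2]; split=> //.
have i1 : rintegrable D (fun=> 1).
  exact: (rintegrable_simple mD finD (msimple_cst R 1)).
apply: (le_rintegrable mD) (rintegrableD mD i1 u2).
- exact: (measurable_rnorm mD mu_).
- move=> t _; rewrite ger0_norm ?rnorm_ge0//.
  by have := sqr_ge0 (rnorm (u t) - 1); have := rnorm_ge0 (u t); nra.
Qed.

Definition reach (u : R -> U) : X :=
  bochner_integral D (fun t => S (T - t) (B (u t))).

Lemma L1_reach (u : R -> U) : L1_fun D u ->
  L1_fun D (fun t => S (T - t) (B (u t))).
Proof.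
move=> [mu_ u1]; have mSBu : strongly_measurable D (fun t => S (T - t) (B (u t))).
  exact/strongly_measurable_semigroup/strongly_measurable_bounded_linear.
split=> //; apply: (le_rintegrable mD) (rintegrableZ mD (M * KB) u1).
  exact: (measurable_rnorm mD mSBu).
move=> t Dt; have /andP[t0 tT] := horizonP Dt.
rewrite ger0_norm ?rnorm_ge0// -mulrA (le_trans (MP _ _))//; first by lra.
by rewrite ler_pM2l.
Qed.

Lemma rdot_reach (u : R -> U) psi : L1_fun D u ->
  rdot (reach u) psi = \int[mu]_(t in D) rdot (u t) (observation psi t).
Proof.
move=> hu; rewrite /reach (rdot_bochner_integral mD finD psi (L1_reach hu)).
by apply: eq_Rintegral => t /set_mem; exact: rdot_observation.
Qed.

Lemma rintegrable_rdot_observation (u : R -> U) psi : L1_fun D u ->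
  rintegrable D (fun t => rdot (u t) (observation psi t)).
Proof.
move=> hu; have := L1_rdot mD psi (L1_reach hu).
apply: eq_integrable; first exact: mD.
by move=> t /set_mem Dt /=; rewrite rdot_observation.
Qed.

Lemma L1_comb (u v : R -> U) (a b : R) : L1_fun D u -> L1_fun D v ->
  L1_fun D (fun t => rscale a (u t) + rscale b (v t)).
Proof.
move=> [[s [ss su]] u1] [[s' [ss' sv]] v1].
have muv : strongly_measurable D (fun t => rscale a (u t) + rscale b (v t)).
  exists (fun n t => rscale a (s n t) + rscale b (s' n t)); split.
    move=> n; apply/simple_funP.
    by apply: (msimple_comp2 (fun x y => rscale a x + rscale b y)); exact/simple_funP.
  by move=> t Dt; apply: cvgD; apply: rscale_cvg; [exact: su|exact: sv].
split=> //; apply: (le_rintegrable mD)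
  (rintegrableD mD (rintegrableZ mD `|a| u1) (rintegrableZ mD `|b| v1)).
  exact: (measurable_rnorm mD muv).
move=> t _; rewrite ger0_norm ?rnorm_ge0// (le_trans (rnormD _ _))//.
by rewrite !rnormZ.
Qed.

Lemma reach_comb (u v : R -> U) (a b : R) : L1_fun D u -> L1_fun D v ->
  reach (fun t => rscale a (u t) + rscale b (v t)) =
  rscale a (reach u) + rscale b (reach v).
Proof.
move=> hu hv; apply: eq_rdot => psi.
rewrite rdotDl !rdotZl !rdot_reach//; last exact: L1_comb.
have iu := rintegrable_rdot_observation psi hu.
have iv := rintegrable_rdot_observation psi hv.
rewrite -(RintegralZl _ mD iu) -(RintegralZl _ mD iv).
rewrite -(RintegralD mD (rintegrableZ mD a iu) (rintegrableZ mD b iv)).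
by apply: eq_Rintegral => t _; rewrite rdotDl !rdotZl.
Qed.

(** The estimate is in the L^1 distance because that is the convergence supplied by
    [simple_cauchy_L2_limit]. *)
Lemma reach_dist (u v : R -> U) : L1_fun D u -> L1_fun D v ->
  rnorm (reach u - reach v) <=
  M * KB * \int[mu]_(t in D) rnorm (u t - v t).
Proof.
move=> hu hv; set z := reach u - reach v.
have huv := L1_sub mD hu hv.
have J0 : 0 <= \int[mu]_(t in D) rnorm (u t - v t).
  by apply: Rintegral_ge0 => t _; exact: rnorm_ge0.
have [z0|z0] := eqVneq (rnorm z) 0.
  by rewrite z0 !mulr_ge0// ltW.
have z1 : 0 < rnorm z by rewrite lt_def z0 rnorm_ge0.
rewrite -(ler_pM2l z1) -expr2 rnorm_sqr {1}/z rdotBl.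
rewrite !(rdot_bochner_integral mD finD z (L1_reach _))//.
apply: (le_trans (ler_norm _)).
apply: (le_trans (Rintegral_rdot_dist mD z (L1_reach hu) (L1_reach hv))).
rewrite ler_pM2l// -(RintegralZl _ mD huv.2).
apply: le_Rintegral => //.
- exact: (L1_sub mD (L1_reach hu) (L1_reach hv)).2.
- exact: (rintegrableZ mD _ huv.2).
move=> t Dt; have /andP[t0 tT] := horizonP Dt.
have Tt0 : 0 <= T - t by lra.
rewrite -(linear_sub (semigroup_linear hS Tt0)) -(linear_sub linB).
rewrite -mulrA (le_trans (MP _ _))//; first by lra.
by rewrite ler_pM2l.
Qed.

Lemma observation_normE psi :
  observation_norm S B T psi = Num.sqrt (energy (observation psi)).
Proof. by []. Qed.

(** Integrate [|s u + t f|^2 >= 0] and optimize over [s] and [t]. The sign is the one needed when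
    [S(T) y0] is written as the final state minus [reach u]. *)
Lemma rdot_reach_le (u : R -> U) psi : L2_fun D u ->
  - rdot (reach u) psi <= Num.sqrt (energy u) * observation_norm S B T psi.
Proof.
move=> hu; have /L2_funP[_ u2] := hu; have u1 := L2_L1 hu.
have f2 := square_integrable_observation psi.
have iuf := rintegrable_rdot_observation psi u1.
rewrite observation_normE rdot_reach//.
apply: quadratic_cauchy_schwarz; [exact: energy_ge0|exact: energy_ge0|].
move=> s t s0 t0; rewrite mulrN -mulNr.
rewrite -(RintegralZl _ mD iuf) -(RintegralZl _ mD u2) -(RintegralZl _ mD f2).
rewrite -(RintegralD mD (rintegrableZ mD _ u2) (rintegrableZ mD _ f2)).
apply: le_Rintegral.
- exact: mD.
- exact: (rintegrableZ mD (- (2 * (s * t))) iuf).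
- exact: (rintegrableD mD (rintegrableZ mD (s ^+ 2) u2) (rintegrableZ mD (t ^+ 2) f2)).
move=> r _.
have := sqr_ge0 (rnorm (rscale s (u r) + rscale t (observation psi r))).
rewrite rnormD_sqr !rnormZ_sqr rdotZl rdotZr; lra.
Qed.

End control_operator.

(** * L^2 limits of simple controls *)

Lemma geometric_cauchy_limit (R : realType) (k : scalar_kind)
    (X : hilbertType R k) (x : nat -> X) (c : R) : 0 <= c ->
  (forall n, rnorm (x n.+1 - x n) <= c * 2^-1 ^+ n) ->
  exists2 z, x @ \oo --> z & forall n, rnorm (z - x n) <= 2 * c * 2^-1 ^+ n.
Proof.
move=> c0 xc.
(* Keeping the subtracted remainder of the geometric series makes the induction on [m] close
   exactly. *)
have tail n m : rnorm (x (n + m)%N - x n) <=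
    2 * c * 2^-1 ^+ n - 2 * c * 2^-1 ^+ (n + m).
  elim: m => [|m IH]; first by rewrite addn0 !subrr rnorm0.
  apply: (le_trans (rnorm_triangle (x (n + m)%N) _ _)).
  rewrite addnS; apply: (le_trans (lerD (xc _) IH)).
  by rewrite exprSr; lra.
have p0 n : 0 <= 2 * c * 2^-1 ^+ n by rewrite !mulr_ge0// exprn_ge0.
have tail' n m : (n <= m)%N -> rnorm (x m - x n) <= 2 * c * 2^-1 ^+ n.
  by move=> /subnKC <-; apply: (le_trans (tail _ _)); rewrite lerBlDr lerDl.
have to0 : 2 * c * 2^-1 ^+ n @[n --> \oo] --> 0.
  rewrite -(mulr0 (2 * c)); apply: cvgMr.
  by apply: cvg_expr; rewrite ger0_norm ?invf_lt1 ?ltr1n.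
have /cvg_ex[z xz] : cvgn x.
  apply: rnorm_complete => e e0.
  have e2 : 0 < e / 2 by rewrite divr_gt0.
  have /cvgrPdist_lt/(_ _ e2)[N _ NP] := to0.
  have bN : 2 * c * 2^-1 ^+ N < e / 2.
    by have := NP N (leqnn N); rewrite /= sub0r normrN ger0_norm.
  exists N => n m Nn Nm.
  apply: le_lt_trans (rnorm_triangle (x N) _ _) _.
  rewrite (rnormC (x N)) [e]splitr ltrD//.
    exact: le_lt_trans (tail' _ _ Nn) bN.
  exact: le_lt_trans (tail' _ _ Nm) bN.
exists z => // n.
apply: (@ler_cvg_to nat \oo _ R (fun m => rnorm (x m - x n))
  (fun=> 2 * c * 2^-1 ^+ n)).
- by apply: rnorm_cvg; apply: cvgB => //; exact: cvg_cst.
- exact: cvg_cst.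
- by exists n => // m /= nm; exact: tail'.
Qed.

Section square_integrable_limits.
Variables (R : realType) (k : scalar_kind) (U : hilbertType R k) (T : R).
Local Notation mR := (measurableTypeR R).
Local Notation mu := (@lebesgue_measure R).
Local Notation D := (`]0, T[%classic : set R).
Local Notation mD := (measurable_horizon T).
Local Notation finD := (finite_horizon T).

Lemma simple_fun_comp2 (F : U -> U -> U) (s s' : R -> U) : simple_fun s ->
  simple_fun s' -> simple_fun (fun t => F (s t) (s' t)).
Proof.
by move=> /simple_funP ss /simple_funP ss'; apply/simple_funP; exact: msimple_comp2.
Qed.

Lemma square_integrable_simple (s : R -> U) : simple_fun s ->
  square_integrable T s.
Proof.
move=> /simple_funP ss; apply: (rintegrable_simple mD finD).
exact: (msimple_comp (fun v => rnorm v ^+ 2)).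
Qed.

Lemma simple_L2 (s : R -> U) : simple_fun s -> L2_fun D s.
Proof.
move=> ss; apply/L2_funP; split; first exact: simple_strongly_measurable.
exact: square_integrable_simple.
Qed.

(* The series [g] of the weighted squared increments is integrable, hence finite
   almost everywhere; where it is finite the sequence converges geometrically. *)
Lemma simple_cauchy_L2_limit (w : nat -> R -> U) :
  (forall n, simple_fun (w n)) ->
  (forall n, energy T (fun t => w n.+1 t - w n t) <= 8^-1 ^+ n) ->
  exists2 u, L2_fun D u &
    \int[mu]_(t in D) rnorm (u t - w n t) @[n --> \oo] --> 0.
Proof.
move=> sw wC.
pose dl n t := rnorm (w n.+1 t - w n t) ^+ 2.
have dl0 n t : 0 <= dl n t by exact: sqr_ge0.
have idl n : rintegrable D (dl n).
  apply: square_integrable_simple.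
  exact: (simple_fun_comp2 (fun a b => a - b)).
(* The weight [4^n] is a compromise: against [8^-n] it leaves a convergent series of sum 2, and
   finiteness of [g t] bounds the increments by [sqrt (g t) * 2^-n]. *)
pose h n (t : mR) := (4 ^+ n * dl n t)%:E.
have h0 n t : (0 <= h n t)%E by rewrite lee_fin mulr_ge0// exprn_ge0.
have ih n : mu.-integrable D (h n) by exact: (rintegrableZ mD (4 ^+ n) (idl n)).
have mh n : measurable_fun (D : set mR) (h n) by exact: measurable_int (ih n).
pose g t := (\sum_(0 <= n <oo) h n t)%E.
have g0 t : (0 <= g t)%E by apply: nneseries_ge0 => n _ _.
have mg : measurable_fun (D : set mR) g.
  by apply: ge0_emeasurable_sum => // n t _ _.
have ig_le : (\int[mu]_(t in D) g t <= 2%:E)%E.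
  rewrite /g (integral_nneseries mu mD mh (fun n t _ => h0 n t)).
  apply: lime_le.
    by apply: is_cvg_nneseries => n _ _; exact: integral_ge0.
  apply: nearW => N.
  have -> : (\sum_(0 <= n < N) \int[mu]_(t in D) h n t =
      (\sum_(0 <= n < N) 4 ^+ n * energy T (fun t => w n.+1 t - w n t))%:E)%E.
    rewrite -sumEFin; apply: eq_bigr => n _.
    rewrite -(RintegralZl _ mD (idl n)) /Rintegral fineK//.
    exact: (integrable_fin_num mD (ih n)).
  rewrite lee_fin.
  apply: (@le_trans _ _ (2 - 2 * 2^-1 ^+ N)); last first.
    by rewrite lerBlDr lerDl mulr_ge0// exprn_ge0.
  elim: N => [|N IH]; first by rewrite big_geq// expr0; lra.
  rewrite big_nat_recr//=.
  have : 4 ^+ N * energy T (fun t => w N.+1 t - w N t) <= 2^-1 ^+ N.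
    apply: (@le_trans _ _ (4 ^+ N * 8^-1 ^+ N)).
      by rewrite ler_wpM2l ?exprn_ge0.
    rewrite -exprMn (_ : 4 * 8^-1 = 2^-1 :> R)//; by field.
  by move: IH; rewrite exprSr; lra.
have ig : mu.-integrable D g.
  apply/integrableP; split => //.
  under eq_integral do rewrite gee0_abs//.
  by apply: (le_lt_trans ig_le); rewrite ltry.
pose E := D `&` [set t | g t \is a fin_num].
have mE : measurable (E : set mR) by exact: emeasurable_fin_num.
pose c t := Num.sqrt (fine (g t)).
have term n t : E t -> rnorm (w n.+1 t - w n t) <= c t * 2^-1 ^+ n.
  move=> [Dt gt].
  have hg : 4 ^+ n * dl n t <= fine (g t).
    rewrite -lee_fin fineK//.
    apply: (@le_trans _ _ (\sum_(0 <= i < n.+1) h i t)%E).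
      by rewrite big_nat_recr//= leeDr// sume_ge0.
    by apply: nneseries_lim_ge => i _ _.
  rewrite -(@ler_pXn2r _ 2)// ?nnegrE ?rnorm_ge0 ?mulr_ge0 ?sqrtr_ge0 ?exprn_ge0//.
  rewrite exprMn sqr_sqrtr ?fine_ge0// -exprM mulnC exprM.
  have p4 : 0 < (4 : R) ^+ n by rewrite exprn_gt0.
  rewrite (_ : (2^-1) ^+ 2 = 4^-1 :> R); last by field.
  by rewrite exprVn ler_pdivlMr// mulrC.
(* [strongly_measurable] asks for convergence at every point of [D], so the approximations are set
   to zero where [g] is infinite. *)
pose s n t := if t \in E then w n t else 0.
have ss n : simple_fun (s n).
  apply/simple_funP; apply: (msimple_comp2 (fun (b : bool) v => if b then v else 0)).
    exact: msimple_mem.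
  exact/simple_funP.
have /choice[u uP] t : exists z, s n t @[n --> \oo] --> z /\
    (E t -> forall n, rnorm (z - w n t) <= 2 * c t * 2^-1 ^+ n).
  have [Et|nEt] := pselect (E t).
    have [z wz zw] := geometric_cauchy_limit (sqrtr_ge0 _) (fun n => term n t Et).
    exists z; split => //; rewrite (_ : (fun n => s n t) = w^~ t)//.
    by apply/funext => n; rewrite /s mem_set.
  exists 0; split => //; rewrite (_ : (fun n => s n t) = fun=> 0).
    exact: cvg_cst.
  by apply/funext => n; rewrite /s memNset.
have smu : strongly_measurable D u.
  by exists s; split => // t Dt; exact: (uP t).1.
have ig1 : mu.-integrable D (fun t => 1%:E + g t)%E.
  apply: integrableD => //.
  exact: (rintegrable_simple mD finD (msimple_cst R 1)).
(* With [c^2 = g], the pointwise bound [2 c 2^-n] is dominated through [c <= 1 + c^2]. *)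
have uw_le n : (\int[mu]_(t in D) (rnorm (u t - w n t))%:E <=
    (2 * 2^-1 ^+ n)%:E * \int[mu]_(t in D) (1%:E + g t))%E.
  rewrite -(integralZl mD ig1).
  have p0 : 0 <= 2 * 2^-1 ^+ n :> R by rewrite mulr_ge0// exprn_ge0.
  apply: ae_ge0_le_integral.
  - exact: mD.
  - by move=> t _; rewrite lee_fin rnorm_ge0.
  - apply/measurable_EFinP; apply: (measurable_rnorm mD (f := fun t => u t - w n t)).
    by apply: strongly_measurable_sub => //; exact: simple_strongly_measurable.
  - by move=> t _; rewrite mule_ge0 ?lee_fin// adde_ge0.
  - exact: measurable_int (integrableZl mD (2 * 2^-1 ^+ n) ig1).
  - apply: filterS (integrable_ae mD ig) => t gt' Dt; have gt := gt' Dt.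
    have Et : E t by split.
    rewrite -(fineK gt) -EFinD -EFinM lee_fin.
    apply: (le_trans ((uP t).2 Et n)).
    rewrite mulrAC ler_wpM2l//.
    have h1 := sqr_sqrtr (fine_ge0 (g0 t)); rewrite -/(c t) in h1.
    have h2 : 0 <= c t by exact: sqrtr_ge0.
    by have := sqr_ge0 (c t - 1); rewrite -h1; nra.
exists u.
  split => //.
  (* This majorant comes from [(2 c + |w 0|)^2 <= 8 c^2 + 2 |w 0|^2]. *)
  have iB : mu.-integrable D (fun t => (2 * rnorm (w 0%N t) ^+ 2)%:E + 8%:E * g t)%E.
    apply: integrableD => //; last exact: integrableZl.
    exact: (rintegrableZ mD 2 (square_integrable_simple (sw 0%N))).
  apply: le_lt_trans _ (integrable_lty mD iB).
  apply: ae_ge0_le_integral.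
  - exact: mD.
  - by move=> t _; rewrite lee_fin sqr_ge0.
  - by apply/measurable_EFinP; exact: measurable_rnorm_sqr.
  - by move=> t _; rewrite adde_ge0 ?mule_ge0 ?lee_fin// mulr_ge0 ?sqr_ge0.
  - exact: measurable_int iB.
  - apply: filterS (integrable_ae mD ig) => t gt' Dt; have gt := gt' Dt.
    have Et : E t by split.
    rewrite -(fineK gt) -EFinM -EFinD lee_fin.
    have := (uP t).2 Et 0%N; rewrite expr0 mulr1 => h1.
    have := sqr_sqrtr (fine_ge0 (g0 t)); rewrite -/(c t) => h2.
    have h3 : rnorm (u t) <= 2 * c t + rnorm (w 0%N t).
      by rewrite -{1}(subrK (w 0%N t) (u t)) (le_trans (rnormD _ _))// lerD2r.
    have h4 : rnorm (u t) ^+ 2 <= (2 * c t + rnorm (w 0%N t)) ^+ 2.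
      by rewrite ler_pXn2r// nnegrE ?rnorm_ge0// (le_trans _ h3)// rnorm_ge0.
    have := sqr_ge0 (2 * c t - rnorm (w 0%N t)).
    by rewrite -h2; nra.
have J_fin := integrable_fin_num mD ig1.
set J := (\int[mu]_(t in D) (1%:E + g t))%E in uw_le J_fin.
apply: (@squeeze_cvgr _ _ _ _ (fun=> 0) (fun n => 2 * 2^-1 ^+ n * fine J)).
- apply: nearW => n; apply/andP; split.
    by apply: Rintegral_ge0 => t _; exact: rnorm_ge0.
  rewrite -[leRHS]/(fine (2 * 2^-1 ^+ n * fine J)%:E) EFinM fineK//.
  have i0 : (0 <= \int[mu]_(t in D) (rnorm (u t - w n t))%:E)%E.
    by apply: integral_ge0 => t _; rewrite lee_fin rnorm_ge0.
  have ff : ((2 * 2^-1 ^+ n)%:E * J)%E \is a fin_num by rewrite fin_numM.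
  apply: fine_le => //.
  rewrite ge0_fin_numE//; apply: (le_lt_trans (uw_le n)).
  by rewrite ltey_eq ff.
- exact: cvg_cst.
- rewrite -(mul0r (fine J)); apply: cvgMl; rewrite -(mulr0 2); apply: cvgMr.
  by apply: cvg_expr; rewrite ger0_norm ?invf_lt1 ?ltr1n.
Qed.

End square_integrable_limits.

(** * Exact reachability from observability *)

Section reachability.
Variables (R : realType) (k : scalar_kind) (X U : hilbertType R k).
Variables (S : R -> X -> X) (hS : C0_semigroup S) (B : {linear U -> X}).
Variables (T M KB : R).
Hypothesis M1 : 1 <= M.
Hypothesis MP : forall t x, 0 <= t <= T -> rnorm (S t x) <= M * rnorm x.
Hypothesis KB0 : 0 < KB.
Hypothesis KBP : forall u, rnorm (B u) <= KB * rnorm u.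
Local Notation mR := (measurableTypeR R).
Local Notation mu := (@lebesgue_measure R).
Local Notation D := (`]0, T[%classic : set R).
Local Notation mD := (measurable_horizon T).
Local Notation obs := (observation S B T).

Variables (y : X) (a C : R).
Hypothesis a0 : 0 <= a.
Hypothesis C0 : 0 < C.
Hypothesis yC : forall psi,
  rdot psi y <= C * observation_norm S B T psi + a * rnorm psi.

Let rdotG (u : R -> U) psi : simple_fun u ->
  rdot (reach S B T u) psi = \int[mu]_(t in D) rdot (u t) (obs psi t).
Proof. by move=> su; apply: (rdot_reach hS M1 MP KB0 KBP); exact/L2_L1/simple_L2. Qed.

Let combG (u v : R -> U) r s : simple_fun u -> simple_fun v ->
  reach S B T (fun t => rscale r (u t) + rscale s (v t)) =
  rscale r (reach S B T u) + rscale s (reach S B T v).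
Proof.
by move=> su sv; apply: (reach_comb hS M1 MP KB0 KBP); exact/L2_L1/simple_L2.
Qed.

Let simple_comb (u v : R -> U) r s : simple_fun u -> simple_fun v ->
  simple_fun (fun t => rscale r (u t) + rscale s (v t)).
Proof. exact: (simple_fun_comp2 (fun p q => rscale r p + rscale s q)). Qed.

(** The gap between the two sides is the integral of [r (1 - r) |u - v|^2]. *)
Let energy_comb (u v : R -> U) r : simple_fun u -> simple_fun v ->
  0 <= r <= 1 ->
  energy T (fun t => rscale (1 - r) (u t) + rscale r (v t)) <=
  (1 - r) * energy T u + r * energy T v.
Proof.
move=> su sv /andP[r0 r1].
have iu := square_integrable_simple T su.
have iv := square_integrable_simple T sv.
rewrite /energy -(RintegralZl _ mD iu) -(RintegralZl _ mD iv).
have i1 := rintegrableZ mD (1 - r) iu.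
have i2 := rintegrableZ mD r iv.
rewrite -(RintegralD mD i1 i2).
apply: le_Rintegral.
- exact: mD.
- exact: (square_integrable_simple T (simple_comb (1 - r) r su sv)).
- exact: (rintegrableD mD i1 i2).
move=> t _; rewrite rnormD_sqr !rnormZ_sqr rdotZl rdotZr.
have := sqr_ge0 (rnorm (u t - v t)); rewrite rnormB_sqr => H.
have := mulr_ge0 (mulr_ge0 r0 (_ : 0 <= 1 - r)) H.
rewrite subr_ge0 => /(_ r1); lra.
Qed.

(** With [O] the norm of [f z], the extremal control would be [- (C / O) f z], which need not be
    simple. Its simple approximations may slightly exceed the energy bound, so multiples [l] with
    [l O < C] are used instead, and [l] is fixed while [n] grows. *)
Lemma observation_dual_bound z m :
  (forall u, simple_fun u -> energy T u <= C ^+ 2 ->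
    - rdot (reach S B T u) z <= m) ->
  C * observation_norm S B T z <= m.
Proof.
move=> H.
have [v [sv vM vf]] := observation_approx hS M1 MP KB0 KBP z.
have O0 : 0 <= observation_norm S B T z by rewrite observation_normE sqrtr_ge0.
have O2 : observation_norm S B T z ^+ 2 = energy T (obs z).
  by rewrite observation_normE sqr_sqrtr// energy_ge0.
set O := observation_norm S B T z in O0 O2 *.
pose K := KB * (M * rnorm z).
have K0 : 0 <= K.
  by rewrite !mulr_ge0 ?rnorm_ge0 ?(ltW KB0)// (le_trans ler01 M1).
(* The null second term lets the lemmas on combinations of two controls serve for scaling. *)
have scaled_simple l n : simple_fun (fun t => rscale l (v n t) + rscale 0 (v n t)).
  exact: simple_comb.
have scaled_reach l n :
    rdot (reach S B T (fun t => rscale l (v n t) + rscale 0 (v n t))) z =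
    l * \int[mu]_(t in D) rdot (v n t) (obs z t).
  by rewrite combG// rscale0 addr0 rdotZl rdotG.
have scaled_energy l n :
    energy T (fun t => rscale l (v n t) + rscale 0 (v n t)) =
    l ^+ 2 * energy T (v n).
  rewrite /energy -(RintegralZl _ mD (square_integrable_simple T (sv n))).
  by apply: eq_Rintegral => t _; rewrite rscale0 addr0 rnormZ_sqr.
have cE : energy T (v n) @[n --> \oo] --> O ^+ 2.
  rewrite O2; apply: (@Rintegral_bounded_cvg R T _ _ (K ^+ 2)).
  - by move=> n; apply: measurable_rnorm_sqr; exact: simple_strongly_measurable.
  - move=> n t Dt; rewrite ger0_norm ?sqr_ge0// ler_pXn2r// ?nnegrE ?rnorm_ge0//.
    exact: vM.
  - move=> t Dt; rewrite expr2; under eq_fun do rewrite expr2.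
    by apply: cvgM; apply: rnorm_cvg; exact: vf.
have cI : \int[mu]_(t in D) rdot (v n t) (obs z t) @[n --> \oo] --> O ^+ 2.
  rewrite O2 /energy; under [X in _ --> X]eq_Rintegral do rewrite rnorm_sqr.
  have mf := strongly_measurable_observation hS M1 MP KB0 KBP z.
  apply: (@Rintegral_bounded_cvg R T _ _ (K * K)).
  - move=> n.
    have v1 := L2_L1 (simple_L2 T (sv n)).
    have := rintegrable_rdot_observation hS M1 MP KB0 KBP z v1.
    by move=> /measurable_int /measurable_EFinP.
  - move=> n t Dt; apply: (le_trans (rdot_le _ _)).
    have := Dt; rewrite /= in_itv/= => /andP[t0 tT].
    apply: ler_pM; rewrite ?rnorm_ge0//; first exact: vM.
    by apply: (rnorm_observation hS M1 MP KB0 KBP); lra.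
  - by move=> t Dt; apply: rdot_cvg; [exact: vf|exact: cvg_cst].
(* Test with the zero control; this settles [O = 0] and makes the later [l] nonnegative. *)
have m0 : 0 <= m.
  have := H _ (scaled_simple 0 0%N).
  rewrite scaled_energy scaled_reach !mul0r oppr0 expr0n mul0r; apply.
  exact: sqr_ge0.
(* Test with the controls [- l v_n], admissible for large [n]. *)
have main l : 0 <= l -> l * O < C -> l * O ^+ 2 <= m.
  move=> l0 lO.
  have lO2 : l ^+ 2 * O ^+ 2 < C ^+ 2.
    by rewrite -exprMn ltr_pXn2r// nnegrE ?mulr_ge0// ltW.
  apply: (@ler_cvg_to nat \oo _ R
    (fun n => l * \int[mu]_(t in D) rdot (v n t) (obs z t)) (fun=> m)).
  - exact: cvgMr.
  - exact: cvg_cst.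
  have cE' : l ^+ 2 * energy T (v n) @[n --> \oo] --> l ^+ 2 * O ^+ 2.
    exact: cvgMr.
  apply: filterS (cvgr_lt _ cE' _ lO2) => n ln.
  have := H _ (scaled_simple (- l) n).
  by rewrite scaled_energy scaled_reach sqrrN mulNr opprK => /(_ (ltW ln)).
have [->|O1] := eqVneq O 0; first by rewrite mulr0.
have {}O1 : 0 < O by rewrite lt_def O1.
rewrite leNgt; apply/negP => mCO.
(* If [m < C O], the midpoint is still admissible, as [l O < C], yet gives [l O^2 > m]. *)
pose l := (m / O ^+ 2 + C / O) / 2.
have O21 : 0 < O ^+ 2 by rewrite exprn_gt0.
have mC : m / O ^+ 2 < C / O.
  by rewrite ltr_pdivrMr// expr2 mulrA divfK// gt_eqF.
have l1 : l < C / O by rewrite /l; lra.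
have l2 : m / O ^+ 2 < l by rewrite /l; lra.
have l0 : 0 <= l by apply: le_trans (ltW l2); rewrite divr_ge0// ltW.
rewrite ltr_pdivlMr// in l1; rewrite ltr_pdivrMr// in l2.
by have := main l l0 l1; rewrite leNgt l2.
Qed.

Lemma approximate_reach (eta : R) : 0 < eta -> exists u : R -> U,
  [/\ simple_fun u, energy T u <= C ^+ 2 & rnorm (y + reach S B T u) < a + eta].
Proof.
move=> eta0.
pose K := [set y + reach S B T u | u in [set u : R -> U |
  simple_fun u /\ energy T u <= C ^+ 2]].
have s0 : simple_fun (fun _ : R => 0 : U) by apply/simple_funP; exact: msimple_cst.
have [||z [[x Kx xz] zK]] := @min_norm R k X K.
- exists (y + reach S B T (fun=> 0)); exists (fun=> 0) => //; split => //.
  rewrite /energy; under eq_Rintegral do rewrite rnorm0 expr0n.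
  by rewrite /Rintegral integral0 sqr_ge0.
- move=> _ _ r [u [su qu] <-] [v [sv qv] <-] r01.
  exists (fun t => rscale (1 - r) (u t) + rscale r (v t)).
    split; first exact: simple_comb.
    apply: (le_trans (energy_comb su sv r01)).
    have /andP[r0 r1] := r01.
    have -> : C ^+ 2 = (1 - r) * C ^+ 2 + r * C ^+ 2 by ring.
    by rewrite lerD// ler_wpM2l// subr_ge0.
  rewrite combG// !rscaleDr addrACA -rscaleDl subrK rscale1.
  by [].
have za : rnorm z <= a.
  have CO : C * observation_norm S B T z <= rdot y z - rnorm z ^+ 2.
    apply: observation_dual_bound => u su qu.
    have := zK (y + reach S B T u); rewrite rdotDl.
    have Ku : K (y + reach S B T u) by exists u.
    by move=> /(_ Ku); lra.
  (* Combined with [CO], the terms in the observation norm cancel and leave [|z|^2 <= a |z|]. *)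
  have := yC z; rewrite rdotC => yz.
  have [->//|z0] := eqVneq (rnorm z) 0.
  have z1 : 0 < rnorm z by rewrite lt_def z0 rnorm_ge0.
  by rewrite -(ler_pM2r z1) -expr2; lra.
have zeta : rnorm z < a + eta by lra.
have [N _ NP] := cvgr_lt _ (rnorm_cvg xz) _ zeta.
have := NP N (leqnn N); have [u [su qu] <-] := Kx N => H.
by exists u.
Qed.

Lemma exact_reach : exists2 u : R -> U, L2_fun D u &
  rnorm (y + reach S B T u) <= a.
Proof.
(* The energy constraint is dropped from the sets: [C ^+ 2] now only bounds the minimal energies,
   through [approximate_reach]. *)
pose F n := [set u : R -> U | simple_fun u /\
  rnorm (y + reach S B T u) <= a + n.+1%:R^-1].
have [|||||u [Fu _ uC]] := @almost_minimizers_cauchy R (R -> U) F (energy T)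
  (fun u v => energy T (fun t => u t - v t))
  (fun u v t => rscale (1 - 2^-1) (u t) + rscale 2^-1 (v t)) (C ^+ 2).
- move=> n m nm u [su yu]; split => //; apply: (le_trans yu).
  by rewrite lerD2l lef_pV2 ?posrE// ler_nat.
- move=> n u v [su yu] [sv yv]; split; first exact: simple_comb.
  rewrite combG//.
  have -> : y + (rscale (1 - 2^-1) (reach S B T u) + rscale 2^-1 (reach S B T v)) =
      rscale (1 - 2^-1) (y + reach S B T u) + rscale 2^-1 (y + reach S B T v).
    by rewrite !rscaleDr addrACA -rscaleDl subrK rscale1.
  apply: (le_trans (rnormD _ _)); rewrite !rnormZ.
  have h2 : 0 <= 1 - 2^-1 :> R by lra.
  rewrite (ger0_norm h2) (@ger0_norm _ 2^-1)//.
  by move: yu yv; move: (a + _) (rnorm _) (rnorm _) => *; lra.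
- move=> u v [su _] [sv _].
  have iu := square_integrable_simple T su.
  have iv := square_integrable_simple T sv.
  have im := square_integrable_simple T (simple_comb (1 - 2^-1) 2^-1 su sv).
  rewrite /energy -(RintegralZl _ mD iu) -(RintegralZl _ mD iv) -(RintegralZl _ mD im).
  have i1 := rintegrableZ mD 2 iu; have i2 := rintegrableZ mD 2 iv.
  rewrite -(RintegralD mD i1 i2).
  rewrite -(RintegralB mD (rintegrableD mD i1 i2) (rintegrableZ mD 4 im)).
  apply: eq_Rintegral => t _.
  rewrite !rnormB_sqr rnormD_sqr !rnormZ_sqr rdotZl rdotZr.
  by field.
- by move=> u; exact: energy_ge0.
- move=> n; have [|u [su qu yu]] := @approximate_reach n.+1%:R^-1.
    by rewrite invr_gt0.
  by exists u => //; split => //; exact: ltW.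
have /choice[N NP] (n : nat) : exists N, forall p q, (N <= p)%N -> (N <= q)%N ->
    energy T (fun t => u p t - u q t) < 8^-1 ^+ n.
  by apply: uC; rewrite exprn_gt0.
(* The indices dominate [N n], which gives increments of energy below [8^-n], and also [n], which
   keeps the miss of the target below [n.+1%:R^-1]. *)
pose phi n := (\sum_(i < n.+1) (N i).+1)%N.
have phiS n : phi n.+1 = (phi n + (N n.+1).+1)%N by rewrite /phi big_ord_recr.
have phiN n : (N n <= phi n)%N.
  by rewrite /phi big_ord_recr/= -addSnnS leq_addl.
have phi_ge n : (n <= phi n)%N.
  elim: n => [|n IH] //; rewrite phiS -addSnnS.
  by apply: leq_trans (leq_addr _ _); rewrite ltnS.
pose w n := u (phi n).
have sw n : simple_fun (w n) by exact: (Fu (phi n)).1.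
have [|v v2 vw] := simple_cauchy_L2_limit (T := T) sw.
  move=> n; apply/ltW/NP => //; rewrite phiS.
  exact: (leq_trans (phiN n) (leq_addr _ _)).
exists v => //.
pose I n := \int[mu]_(t in D) rnorm (v t - w n t).
apply: (@ler_cvg_to nat \oo _ R (fun=> rnorm (y + reach S B T v))
  (fun n => (a + n.+1%:R^-1) + M * KB * I n)).
- exact: cvg_cst.
- rewrite -[X in _ --> X]addr0; apply: cvgD; last first.
    by rewrite -(mulr0 (M * KB)); exact: cvgMr.
  rewrite -[X in _ --> X]addr0; apply: cvgD; [exact: cvg_cst|exact: cvg_harmonic].
apply: nearW => n.
have -> : y + reach S B T v =
    y + reach S B T (w n) + (reach S B T v - reach S B T (w n)).
  by rewrite addrAC addrA subrK.
apply: (le_trans (rnormD _ _)); apply: lerD.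
  apply: (le_trans (Fu (phi n)).2).
  by rewrite lerD2l lef_pV2 ?posrE// ler_nat ltnS.
by apply: (reach_dist hS M1 MP KB0 KBP); [exact: L2_L1|exact/L2_L1/simple_L2].
Qed.

End reachability.

(** * The optimal observability constant *)

Section observability_constant.
Variables (R : realType) (k : scalar_kind) (X U : hilbertType R k).
Variables (S : R -> X -> X) (B : U -> X) (T alpha : R) (y0 : X).

Let admissible := [set C : R | 0 <= C /\ forall psi : X,
  rdot psi (S T y0) - alpha * rnorm y0 * rnorm psi
    <= C * observation_norm S B T psi].

Let admissibleP C :
  admissible C <-> 0 <= C /\ observability_inequality S B T alpha y0 C.
Proof.
by split=> -[C0 H]; split => // psi; have := H psi; rewrite lerBlDr.
Qed.

Lemma mu_ltyP : (mu S B T alpha y0 < +oo)%E <->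
  exists2 C, 0 <= C & observability_inequality S B T alpha y0 C.
Proof.
split.
  by move=> /ereal_inf_lt[_ [C /admissibleP[C0 H] <-] _]; exists C.
move=> [C C0 H]; apply: le_lt_trans (ltry C).
by apply: ereal_inf_lbound; exists C => //; apply/admissibleP.
Qed.

(** For each [psi] the inequality either does not involve [C], when the observation norm vanishes,
    or is a lower bound on [C]. Both kinds of condition pass to the infimum. *)
Lemma mu_attained : (mu S B T alpha y0 < +oo)%E -> exists C : R,
  [/\ mu S B T alpha y0 = C%:E, 0 <= C,
      observability_inequality S B T alpha y0 C &
      forall C' : R, 0 <= C' ->
        observability_inequality S B T alpha y0 C' -> C <= C'].
Proof.
move=> /mu_ltyP[C1 C10 H1].
have ne : admissible !=set0 by exists C1; apply/admissibleP.
have lb : has_lbound admissible by exists 0 => C [].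
exists (inf admissible); split.
- exact: ereal_inf_EFin.
- by apply: lb_le_inf => // C [].
- move=> psi; rewrite -lerBlDr.
  have O0 : 0 <= observation_norm S B T psi by exact: sqrtr_ge0.
  have [z1|z1] := eqVneq (observation_norm S B T psi) 0.
    by have := H1 psi; rewrite z1 !mulr0 -lerBlDr.
  have {}z1 : 0 < observation_norm S B T psi by rewrite lt_def z1.
  rewrite -ler_pdivrMr//; apply: lb_le_inf => // C [_ CP].
  by rewrite ler_pdivrMr.
- by move=> C' C'0 H; apply: ge_inf => //; apply/admissibleP.
Qed.

End observability_constant.

Theorem theorem1 (R : realType) (k : scalar_kind) (X U : hilbertType R k)
    (S : R -> X -> X) (hS : C0_semigroup S)
    (DA : set X) (A : DA -> X) (hA : is_generator S A)
    (B : {linear U -> X}) (hB : continuous B)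
    (T alpha : R) (hT : 0 < T) (halpha : 0 < alpha) :
  let i := null_controllable S B T alpha in
  let ii := forall y0 : X, (mu S B T alpha y0 < +oo)%E in
  let iii := forall y0 : X, exists2 C : R, 0 < C &
               observability_inequality S B T alpha y0 C in
  [/\ i <-> ii, ii <-> iii &
      i \/ ii \/ iii ->
      forall y0 : X, exists C : R,
        [/\ mu S B T alpha y0 = C%:E, 0 <= C,
            observability_inequality S B T alpha y0 C &
            forall C' : R, 0 <= C' ->
              observability_inequality S B T alpha y0 C' -> C <= C']].
Proof.
move=> i ii iii.
have linB : linear B by exact: linearP.
have [KB KB0 KBP] := linear_continuous_rbounded linB hB.
have [M M1 MP] := semigroup_bounded_on hS T.
have ii_iii : ii <-> iii.
  split=> [H y0|H y0].
    have /mu_ltyP[C C0 HC] := H y0.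
    (* Adding 1 makes the constant positive, as (iii) requires, even if the one from (ii) is
       zero. *)
    exists (C + 1) => [|psi]; first by rewrite ltr_wpDl.
    apply: (le_trans (HC psi)).
    by rewrite lerD2r ler_wpM2r ?sqrtr_ge0// lerDl.
  by apply/mu_ltyP; have [C C0 HC] := H y0; exists C => //; exact: ltW.
have i_iii : i -> iii.
  move=> H y0; have [u u2 uy] := H y0.
  exists (Num.sqrt (energy T u) + 1) => [|psi].
    by rewrite ltr_wpDl ?sqrtr_ge0.
  have h1 := rdot_reach_le hS M1 MP KB0 KBP psi u2.
  have h2 := le_trans (ler_norm _) (rdot_le (mild_solution S B T y0 u) psi).
  have h3 := ler_wpM2r (rnorm_ge0 psi) uy.
  have O0 : 0 <= observation_norm S B T psi by exact: sqrtr_ge0.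
  have mildE : mild_solution S B T y0 u = S T y0 + reach S B T u by [].
  by move: h2 h3; rewrite mildE rdotDl (rdotC psi); lra.
have iii_i : iii -> i.
  move=> H y0; have [C C0 HC] := H y0.
  have a0 : 0 <= alpha * rnorm y0 by rewrite mulr_ge0 ?rnorm_ge0// ltW.
  have [u u2 uy] := exact_reach hS M1 MP KB0 KBP a0 C0 HC.
  by exists u.
split=> //; first by split=> [/i_iii/ii_iii|/ii_iii/iii_i].
move=> H y0; apply: mu_attained; suff : ii by exact.
by case: H => [/i_iii/ii_iii|[|/ii_iii]].
Qed.
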